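(* Let $k$ be a field with $\operatorname{char}(k)\neq 5$ and let $c\in k$ satisfy $c^2+c=1$. Let $n\ge 0$, and let $P(n)$, $Q(n)$, $\mathcal G$ and the normal form $\operatorname{NF}_{\mathcal G}$ be as defined in the context. For $\lambda\in P(n)$ and $\mu\in Q(n)$, define $$M_n(\mu,\lambda)=[x^\mu]\operatorname{NF}_{\mathcal G}(x^\lambda),$$ the coefficient of $x^\mu$ in $\operatorname{NF}_{\mathcal G}(x^\lambda)$. After choosing orderings of the finite sets $P(n)$ and $Q(n)$, the matrix $M_n$ (rows indexed by $Q(n)$, columns by $P(n)$) is square and invertible. Moreover, there exists a bijection $\pi_n:P(n)\to Q(n)$ such that $$[x^{\pi_n(\lambda)}]\operatorname{NF}_{\mathcal G}(x^\lambda)\neq 0\qquad\text{for all }\lambda\in P(n).$$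
   Context: $S=k[x_1,x_2,\ldots]$ is the polynomial ring in countably many variables indexed by the positive integers, graded by $\deg x_i=i$ (weighted degree); $S_n$ is the component of weighted degree $n$. Define the sequence $s_j$, with subscripts read modulo $5$, by $s_0=2,\ s_1=c,\ s_2=-1-c,\ s_3=-1-c,\ s_4=c$. For $n\ge 2$, $$g_n=(s_n-c)x_n+\sum_{1\le i<n/2}s_{n-2i}\,x_ix_{n-i}+\begin{cases}x_{n/2}^2,&2\mid n,\\0,&2\nmid n,\end{cases}$$ which is homogeneous of weighted degree $n$. Let $D=\{n\ge 2\mid n\equiv 0,2,3\pmod 5\}$ and $I=(g_n\mid n\in D)\subseteq S$. Let $\mathcal G=\{g_{2m}\mid m\ge 1\}\cup\{c^{-1}g_{2m+1}\mid m\ge 1\}$ (note $c(c+1)=1$). Monomial order. Let $\mathcal M$ be the additive monoid of finitely supported exponent vectors $\alpha=(\alpha_i)_{i\ge1}$ of nonnegative integers, with $x^\alpha=\prod_{i\ge1}x_i^{\alpha_i}$. Put $\operatorname{wt}(\alpha)=\sum_i i\alpha_i$ and $\operatorname{sm}(\alpha)=\sum_i i^2\alpha_i$. For distinct $\alpha,\beta$ let $r=\min\{i\ge 1:\alpha_i\ne\beta_i\}$, and declare $x^\alpha\prec x^\beta$ if (i) $\operatorname{wt}(\alpha)<\operatorname{wt}(\beta)$; or (ii) the weights agree and $\operatorname{sm}(\alpha)>\operatorname{sm}(\beta)$; or (iii) the weights and the values of $\operatorname{sm}$ agree and $\alpha_r<\beta_r$. With respect to this monomial order, $\mathcal G$ is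 the reduced Gröbner basis of $I$, and the initial ideal of $I$ is $J=(x_m^2,x_mx_{m+1}\mid m\ge1)$. Partitions. A partition of $n$ is a multiplicity vector $a=(a_i)_{i\ge1}\in\mathcal M$ with $\sum_{i\ge1}ia_i=n$. $P(n)$ is the set of partitions of $n$ with $a_i=0$ unless $i\equiv 1,4\pmod 5$. $Q(n)$ is the set of partitions of $n$ such that for all $i\ge1$: $a_i\le 1$, and $a_i\ne0$ implies $a_{i+1}=0$. Both sets are finite. A monomial $x^a$ of weighted degree $n$ lies outside $J$ precisely when $a\in Q(n)$. Normal form. Put $V_n=\operatorname{span}_k\{x^\mu:\mu\in Q(n)\}\subseteq S_n$. Every class in $(S/I)_n$ has a unique representative in $V_n$; for $f\in S_n$, $\operatorname{NF}_{\mathcal G}(f)\in V_n$ denotes the unique element of $V_n$ congruent to $f$ modulo $I$ (the remainder of $f$ on division by $\mathcal G$). For $\lambda\in P(n)$, $x^\lambda=\prod_{i\ge1}x_i^{\lambda_i}$. *)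

(* Defs.v *)
From HB Require Import structures.
From Stdlib Require Import ClassicalEpsilon.
From mathcomp Require Import all_boot all_order all_algebra finmap monalg.

Set Implicit Arguments.
Unset Strict Implicit.
Unset Printing Implicit Defensive.

Import GRing.Theory.
Local Open Scope fset_scope.
Local Open Scope ring_scope.

(* k[x_1, x_2, ...] is the monoid algebra {malg k[monom]}.  Variables are
   indexed by the positive integers: the generator j : nat of the free
   commutative monoid stands for x_{j+1}. *)
Notation monom := {cmonom nat}.

(* alpha_i for i >= 1; the value at i = 0 is junk and is never used. *)
Definition expo (a : monom) (i : nat) : nat := a i.-1.

Definition wt (a : monom) : nat :=
  (\sum_(j <- finsupp a) j.+1 * expo a j.+1)%N.

(* In a partition of n the parts and the multiplicities are at most n, so
   finitely many candidates are enough; see mem_partitions. *)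
Definition partitions (n : nat) : {fset monom} :=
  [fset a in [seq (\big[@mmul monom/mone]_(j < n) expcmn (ucm (val j)) (f j))
             | f : {ffun 'I_n -> 'I_n.+1}] | wt a == n].

Definition P (n : nat) : {fset monom} :=
  [fset a in partitions n |
     all (fun j => (j.+1 %% 5 == 1)%N || (j.+1 %% 5 == 4)%N) (finsupp a)].

Definition Q (n : nat) : {fset monom} :=
  [fset a in partitions n |
     all (fun j => (expo a j.+1 <= 1)%N && (expo a j.+2 == 0)%N) (finsupp a)].

Lemma mono_prodE (T : Type) (r : seq T) (F : T -> monom) i :
  (\big[@mmul monom/mone]_(j <- r) F j) i = (\sum_(j <- r) F j i)%N.
Proof.
by elim: r => [|j r IH]; rewrite ?big_nil ?cm1 // !big_cons cmM IH.
Qed.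

Lemma expcmnS (a : monom) m : expcmn a m.+1 = mmul a (expcmn a m).
Proof.
case: m => [|m] //.
by apply/eqP/cmP => l; rewrite cmM /expcmn /= cm1 addn0.
Qed.

Lemma expcmn_ucmE j m i : (expcmn (ucm j) m : monom) i = (m * (j == i))%N.
Proof.
elim: m => [|m IH]; first by rewrite /expcmn /= cm1.
by rewrite expcmnS cmM IH cmU mulSn.
Qed.

Lemma mem_partitions n a : (a \in partitions n) = (wt a == n).
Proof.
rewrite !inE /=; case: (eqVneq (wt a) n) => wa; rewrite ?andbF // andbT.
have le_j j : j \in finsupp a -> (j.+1 <= n)%N /\ (a j <= n)%N.
  move=> ja; have : (j.+1 * a j <= n)%N.
    by rewrite -wa /wt (big_fsetD1 j ja) /= leq_addr.
  have aj : (0 < a j)%N by rewrite lt0n -mem_finsupp.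
  move=> h; split; first exact: leq_trans (leq_pmulr _ aj) h.
  exact: leq_trans (leq_pmull _ (ltn0Sn j)) h.
apply/mapP; exists [ffun j : 'I_n => inord (a j)]; first by rewrite mem_enum.
apply/eqP/cmP => i.
rewrite mono_prodE.
case: (boolP (i \in finsupp a)) => [ia | ia].
  have [ltin len] := le_j _ ia.
  rewrite (bigD1 (Ordinal ltin)) //= expcmn_ucmE eqxx ffunE inordK // muln1 big1 ?addn0 //.
  by move=> j; rewrite -val_eqE /= expcmn_ucmE => /negbTE ->; rewrite muln0.
have a0 : a i = 0%N by apply/eqP; rewrite -[_ == _]negbK -mem_finsupp.
rewrite a0 big1 // => j _; rewrite expcmn_ucmE ffunE.
case: eqP => [ji|]; last by rewrite muln0.
by rewrite ji a0 inordK.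
Qed.

Lemma mem_P n a : a \in P n <->
  wt a = n /\
  (forall i, (0 < i)%N -> ~ (i = 1 %[mod 5] \/ i = 4 %[mod 5]) ->
     expo a i = 0%N).
Proof.
rewrite in_fset /= unfold_in /= mem_partitions; split.
- case/andP => /eqP wa /allP h; split=> // -[//|i] _ ni; apply/eqP.
  rewrite -[_ == _]negbK; apply/negP => ai; apply: ni.
  have /h /orP : i \in finsupp a by rewrite mem_finsupp.
  by case=> /eqP; [left | right].
- case=> /eqP -> h /=; apply/allP => i; rewrite mem_finsupp => ai.
  apply/negPn/negP => ni; case/eqP: ai; apply: (h i.+1) => // h'.
  by move: ni; case: h' => ->.
Qed.

Lemma mem_Q n a : a \in Q n <->
  wt a = n /\
  (forall i, (0 < i)%N -> (expo a i <= 1)%N /\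
     (expo a i <> 0%N -> expo a i.+1 = 0%N)).
Proof.
rewrite in_fset /= unfold_in /= mem_partitions; split.
- case/andP => /eqP wa /allP h; split=> // -[//|i] _.
  case: (boolP (i \in finsupp a)) => ia; first by case/andP: (h _ ia) => ? /eqP.
  have -> : expo a i.+1 = 0%N by apply/eqP; rewrite -[_ == _]negbK -mem_finsupp.
  by split.
- case=> /eqP -> h /=; apply/allP => i; rewrite mem_finsupp => /eqP ai.
  by have [-> h0] := h i.+1 (ltn0Sn i); rewrite h0 ?eqxx.
Qed.

Section Ring.
Variable k : fieldType.
Local Notation S := {malg k[monom]}.

(* x^a *)
Definition mono (a : monom) : S := << a >>.

Definition x (i : nat) : S := mono (ucm i.-1).

Lemma monoE (a : monom) :
  mono a = \prod_(j <- finsupp a) x j.+1 ^+ expo a j.+1.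
Proof.
have monoM (b d : monom) : mono (mmul b d) = mono b * mono d.
  by rewrite malgM_def fgmulUU mulr1.
have monoX (b : monom) m : mono (expcmn b m) = mono b ^+ m.
  by elim: m => [|m IH]; rewrite ?expcmnS ?monoM ?IH ?exprS.
have defa : a = \big[@mmul monom/mone]_(j <- finsupp a) expcmn (ucm j) (a j).
  apply/eqP/cmP => i; rewrite mono_prodE.
  case: (boolP (i \in finsupp a)) => ia.
    rewrite (big_fsetD1 i ia) /= expcmn_ucmE eqxx muln1 big_seq big1 ?addn0 //.
    by move=> j; rewrite !inE => /andP[/negbTE ji _]; rewrite expcmn_ucmE ji muln0.
  have -> : a i = 0%N by apply/eqP; rewrite -[_ == _]negbK -mem_finsupp.
  rewrite big_seq big1 // => j ja; rewrite expcmn_ucmE.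
  by case: eqP => [ji|]; rewrite ?muln0 // -ji ja in ia *.
rewrite {1}defa (big_morph _ monoM (erefl (mono mone))).
by apply: eq_bigr => j _; rewrite monoX.
Qed.

Variable c : k.

Definition s (j : nat) : k := nth 0 [:: 2; c; -1 - c; -1 - c; c] (j %% 5)%N.

Definition g (n : nat) : S :=
  (s n - c) *: x n
  + \sum_(1 <= i < n | (2 * i < n)%N) s (n - 2 * i) *: (x i * x (n - i))
  + (if (2 %| n)%N then x (n %/ 2)%N ^+ 2 else 0).

Definition D (n : nat) : bool :=
  [&& 2 <= n & [|| n %% 5 == 0, n %% 5 == 2 | n %% 5 == 3]]%N.

(* Membership in the ideal I = (g_n | n in D). *)
Definition in_I (f : S) : Prop :=
  exists r : seq (nat * S),
    all (fun p => D p.1) r /\ f = \sum_(p <- r) p.2 * g p.1.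

(* Membership in V_n = span_k {x^mu : mu in Q(n)}. *)
Definition in_V (n : nat) (f : S) : Prop :=
  exists a : Q n -> k, f = \sum_(mu : Q n) a mu *: mono (val mu).

(* The element of V_n congruent to f modulo I.  The definite description is
   meaningful only when it exists and is unique, which is part of what has to
   be shown for f = x^lambda. *)
Definition NF (n : nat) (f : S) : S :=
  epsilon (inhabits 0) (unique (fun r => in_V n r /\ in_I (f - r))).

Definition M (n : nat) (mu : Q n) (lambda : P n) : k :=
  (NF n (mono (val lambda)))@_(val mu).

End Ring.

(* Main.v *)
From HB Require Import structures.
From Stdlib Require Import ClassicalEpsilon.
Require Import Defs.
From mathcomp Require Import all_boot all_order all_algebra all_fingroup finmap monalg.
From mathcomp Require Import zify ring.

Set Implicit Arguments.
Unset Strict Implicit.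
Unset Printing Implicit Defensive.

Import GRing.Theory.
Local Open Scope fset_scope.
Local Open Scope ring_scope.

(** The ideal [I] has two Groebner bases, one for which the standard monomials
    of weight [n] are [P n] and one for which they are [Q n].  So the classes of
    [P n] and of [Q n] are two bases of the same space [(S/I)_n], the matrix [M]
    is the change of basis between them, and it is square and invertible.  Its
    determinant being nonzero, some term of the Leibniz expansion is nonzero,
    and the permutation of that term is the matching [pi].

    For [P] the generators are the [g_n] with [n] in [D] and the leading monomial
    of [g_n] is [x_n], the monomial of largest square moment; its coefficient
    [s_n - c] is invertible because the characteristic is not 5.  The
    leading monomials are pairwise coprime, so there is nothing to check beyond
    [coprime_confluent].

    For [Q] the generators are all the [g_n] with [n >= 2] and the leading
    monomial is the one of smallest square moment, [x_m^2] or [x_m x_{m+1}].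
    Here two things are needed: every [g_n] lies in [I], and the S-pairs of
    overlapping leading monomials reduce to zero.  Both follow from one linear
    syzygy between the [g_n] (lemma [syzygy]), with coefficients in a 5-periodic
    sequence [d]:

      sum_{i < N} d(N + 2i) x_i g_{N-i} + c d(2N) g_N = 0     (x_0 = 1).

    If [N] is 1 or 4 modulo 5, it expresses [g_N] by the [g_j] with [j < N]
    ([quadric_in_ideal]).  For every overlap, whose weight is some [N], the two
    terms of the syzygy that contain the least common multiple of the two
    leading monomials form the S-pair, and all the others are smaller
    ([confluent_overlap]).

    The syzygy is a trigonometric identity.  With [c = 2 cos(2 pi/5)] one has
    [s_j = 2 cos(2 pi j/5)] and [d_j = sin(2 pi j/5) / sin(2 pi/5)], and only
    product formulas for sines and cosines of multiples of [2 pi/5] are used;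
    over [k] these are consequences of [c^2 + c = 1], and [3 + c], which stands
    for [4 sin(2 pi/5)^2], can be cancelled since [(2 - c)(3 + c) = 5]. *)

(** * Linear spans *)

Section Span.
Variables (R : fieldType) (V : lmodType R).
Implicit Types (X Y : V -> Prop) (f h : V).

Inductive linspan X : V -> Prop :=
| linspan0 : linspan X 0
| linspan_cons a f h : X f -> linspan X h -> linspan X (a *: f + h).

Lemma linspan_gen X f : X f -> linspan X f.
Proof.
move=> Xf; rewrite -[f]addr0 -[f in f + _]scale1r.
by apply: linspan_cons => //; exact: linspan0.
Qed.

Lemma linspanD X f h : linspan X f -> linspan X h -> linspan X (f + h).
Proof.
move=> Xf Xh; elim: Xf => [|a u v Xu _ IH]; first by rewrite add0r.
by rewrite -addrA; apply: linspan_cons.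
Qed.

Lemma linspanZ X a f : linspan X f -> linspan X (a *: f).
Proof.
elim=> [|b u v Xu _ IH]; first by rewrite scaler0; exact: linspan0.
by rewrite scalerDr scalerA; apply: linspan_cons.
Qed.

Lemma linspanN X f : linspan X f -> linspan X (- f).
Proof. by move=> Xf; rewrite -scaleN1r; apply: linspanZ. Qed.

Lemma linspanB X f h : linspan X f -> linspan X h -> linspan X (f - h).
Proof. by move=> Xf Xh; apply: linspanD => //; apply: linspanN. Qed.

Lemma linspan_sum X (T : Type) (r : seq T) (Pr : pred T) (F : T -> V) :
  (forall i, Pr i -> linspan X (F i)) -> linspan X (\sum_(i <- r | Pr i) F i).
Proof. by move=> XF; elim/big_ind: _ => //; [exact: linspan0 | exact: linspanD]. Qed.

End Span.

Lemma linspan_linear (R : fieldType) (V W : lmodType R) (phi : {linear V -> W})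
  (X : V -> Prop) (Y : W -> Prop) f :
  (forall u, X u -> linspan Y (phi u)) -> linspan X f -> linspan Y (phi f).
Proof.
move=> XY; elim=> [|a u v Xu _ IH]; first by rewrite linear0; exact: linspan0.
by rewrite linearP; apply: linspanD => //; apply/linspanZ/XY.
Qed.

Lemma linspan_trans (R : fieldType) (V : lmodType R) (X Y : V -> Prop) f :
  (forall u, X u -> linspan Y u) -> linspan X f -> linspan Y f.
Proof. exact: (@linspan_linear _ _ _ (@idfun V)). Qed.

Lemma linspan_kernel (R : fieldType) (V W : lmodType R) (phi : {linear V -> W})
  (X : V -> Prop) f :
  (forall u, X u -> phi u = 0) -> linspan X f -> phi f = 0.
Proof.
move=> X0; elim=> [|a u v Xu _ IH]; first by rewrite linear0.
by rewrite linearP IH X0 // scaler0 addr0.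
Qed.

Lemma eq_linspan (R : fieldType) (V W : lmodType R)
  (phi psi : {linear V -> W}) (X : V -> Prop) f :
  (forall u, X u -> phi u = psi u) -> linspan X f -> phi f = psi f.
Proof.
move=> X0; elim=> [|a u v Xu _ IH]; first by rewrite !linear0.
by rewrite !linearP IH X0.
Qed.

(** * Linear maps given on monomials *)

Section Extension.
Variables (k : fieldType) (W : lmodType k) (F : monom -> W).

Definition extension (f : {malg k[monom]}) : W :=
  \sum_(w <- msupp f) f@_w *: F w.

Lemma extension_supp (d : {fset monom}) f :
  msupp f `<=` d -> extension f = \sum_(w <- d) f@_w *: F w.
Proof.
move=> fd; apply: big_fset_incl => // w _ wf.
by rewrite mcoeff_outdom // scale0r.
Qed.

Lemma extension_is_linear : linear extension.
Proof.
move=> a f h; pose d := msupp f `|` msupp h.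
have fd : msupp f `<=` d by exact: fsubsetUl.
have hd : msupp h `<=` d by exact: fsubsetUr.
have afhd : msupp (a *: f + h) `<=` d.
  apply: fsubset_trans (msuppD_le _ _) _; apply: fsetUSS => //; exact: msuppZ_le.
rewrite (extension_supp fd) (extension_supp hd) (extension_supp afhd).
rewrite scaler_sumr -big_split /=; apply: eq_bigr => w _.
by rewrite mcoeffD mcoeffZ scalerDl scalerA.
Qed.

HB.instance Definition _ :=
  GRing.isLinear.Build k {malg k[monom]} W *:%R extension extension_is_linear.

Lemma extension_mono w : extension (mono k w) = F w.
Proof.
rewrite /extension /mono msuppU oner_eq0 big_seq_fset1.
by rewrite mcoeffUU scale1r.
Qed.

End Extension.

(** * Reduction modulo polynomials with leading monomials *)

(** The ring and its monomials are kept abstract: all that is used is that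
    monomials multiply and that linear maps can be prescribed on them. *)

Section Groebner.
Variables (k : fieldType) (S : comAlgType k) (mon : monom -> S).
Variable ext : (monom -> S) -> {linear S -> S}.
Hypothesis monM : forall a b, mon (mmul a b) = mon a * mon b.
Hypothesis ext_mon : forall F w, ext F (mon w) = F w.

Variables (A : pred nat) (G : nat -> S) (lead : nat -> monom) (lc : nat -> k).
Variables (lev deg : monom -> nat).

Definition mons (Pr : monom -> Prop) (f : S) : Prop :=
  exists2 w, Pr w & f = mon w.

(** Only comparisons after multiplication by a common monomial matter, so [lev]
    need not be compatible with products, and [deg] records the grading that
    reduction preserves. *)
Definition below (l t : monom) : Prop :=
  forall m, (lev (mmul m t) < lev (mmul m l))%N
            /\ deg (mmul m t) = deg (mmul m l).

Hypothesis lc_neq0 : forall i, A i -> lc i != 0.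
Hypothesis tailP : forall i, A i ->
  linspan (mons (below (lead i))) (G i - lc i *: mon (lead i)).

Definition multiple (f : S) : Prop :=
  exists i m, A i /\ f = mon m * G i.

Definition low_multiple (L : nat) (f : S) : Prop :=
  exists i m, [/\ A i, (lev (mmul m (lead i)) < L)%N & f = mon m * G i].

Definition reducible (w : monom) : Prop :=
  exists i m, A i /\ w = mmul m (lead i).

(** The two leading terms cancel when [m * lead i = m' * lead j]. *)
Definition Spair i m j m' : S :=
  (lc i)^-1 *: (mon m * G i) - (lc j)^-1 *: (mon m' * G j).

(** Buchberger's condition in its weak form: the S-pair is a combination of
    multiples of generators whose leading monomials are below the common
    multiple, whether or not it comes from a division. *)
Definition confluent i j : Prop := forall m m',
  mmul m (lead i) = mmul m' (lead j) ->
  linspan (low_multiple (lev (mmul m (lead i)))) (Spair i m j m').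

Lemma lead_tail i m : A i ->
  linspan (mons (fun v => (lev v < lev (mmul m (lead i)))%N
                       /\ deg v = deg (mmul m (lead i))))
       (mon (mmul m (lead i)) - (lc i)^-1 *: (mon m * G i)).
Proof.
move=> Ai; have -> : mon (mmul m (lead i)) - (lc i)^-1 *: (mon m * G i)
    = - (lc i)^-1 *: (mon m * (G i - lc i *: mon (lead i))).
  rewrite mulrBr -scalerAr scalerBr scalerA monM mulNr mulVf ?lc_neq0 //.
  by rewrite scaleN1r scaleNr opprK addrC.
apply: linspanZ; elim: (tailP Ai) => [|a u v [t tb ->] _ IH].
  by rewrite mulr0; exact: linspan0.
rewrite mulrDr -scalerAr; apply: linspan_cons => //.
by exists (mmul m t); rewrite ?monM //; exact: tb.
Qed.

(** Division with remainder, by induction on [lev]; confluence will only bear on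
    the uniqueness of the remainder. *)
Lemma linspan_reduce w : exists2 r,
  linspan (mons (fun v => ~ reducible v /\ deg v = deg w)) r
  & linspan multiple (mon w - r).
Proof.
have [n] := ubnP (lev w); elim: n => // n IH in w *; rewrite ltnS => wn.
have [[i [m [Ai def_w]]]|irr_w] := excluded_middle_informative (reducible w);
  last first.
  exists (mon w); first by apply: linspan_gen; exists w.
  by rewrite subrr; exact: linspan0.
have := lead_tail m Ai; rewrite -def_w => tail.
suff [r r_irr r_eq] : exists2 r,
    linspan (mons (fun v => ~ reducible v /\ deg v = deg w)) r
    & linspan multiple (mon w - (lc i)^-1 *: (mon m * G i) - r).
  exists r => //; rewrite -[mon w - r](addrNK ((lc i)^-1 *: (mon m * G i))).
  apply: linspanD; first by rewrite addrAC.
  by apply/linspanZ/linspan_gen; exists i, m.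
elim: tail => [|a u v [t [t_lev t_deg] ->] _ [r r_irr r_eq]].
  by exists 0; rewrite ?subrr; exact: linspan0.
have [|r1 r1_irr r1_eq] := IH t; first exact: leq_trans t_lev wn.
exists (a *: r1 + r).
  by apply: linspanD => //; apply: linspanZ; rewrite -t_deg.
have -> : a *: mon t + v - (a *: r1 + r) = a *: (mon t - r1) + (v - r).
  by rewrite scalerBr opprD addrACA.
by apply: linspanD => //; apply: linspanZ.
Qed.

Lemma redexP w : {o : option (nat * monom) |
  if o is Some (i, m) then A i /\ w = mmul m (lead i) else ~ reducible w}.
Proof.
apply: constructive_indefinite_description.
have [[i [m im]]|irr_w] := excluded_middle_informative (reducible w).
  by exists (Some (i, m)).
by exists None.
Qed.

(** Full reduction of the monomial [w], with one chosen reduction step at each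
    reducible monomial; [n] bounds the depth of the recursion, and every [n]
    above [lev w] gives the same value. *)
Fixpoint nf (n : nat) (w : monom) : S :=
  if n is n'.+1 then
    if sval (redexP w) is Some (i, m)
    then ext (nf n') (mon w - (lc i)^-1 *: (mon m * G i))
    else mon w
  else 0.

Lemma nf_fuel n n' w : (lev w < n)%N -> (lev w < n')%N -> nf n w = nf n' w.
Proof.
elim: n n' w => // n IH [//|n'] w; rewrite !ltnS /= => wn wn'.
case: (redexP w) => [[[i m]|] //= [Ai def_w]].
rewrite [in LHS]def_w [in RHS]def_w.
apply: eq_linspan (lead_tail m Ai) => _ [v [v_lev _] ->].
by rewrite !ext_mon; rewrite -def_w in v_lev; apply: IH; exact: leq_trans v_lev _.
Qed.

Definition reduce : {linear S -> S} := ext (fun w => nf (lev w).+1 w).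

Lemma reduce_irred f : linspan (mons (fun w => ~ reducible w)) f -> reduce f = f.
Proof.
apply: (@eq_linspan _ _ _ reduce (@idfun S)) => _ [w irr_w ->] /=.
rewrite ext_mon /=; case: (redexP w) => [[[i m]|] //= [Ai def_w]].
by exfalso; apply: irr_w; exists i, m.
Qed.

(** The step that [nf] chooses at [w] kills the corresponding multiple of a
    generator by construction. *)
Lemma reduce_redex w i m :
  sval (redexP w) = Some (i, m) -> reduce (mon m * G i) = 0.
Proof.
move=> red_w; have := svalP (redexP w); rewrite red_w => -[Ai def_w].
suff : reduce (mon w)
       = reduce (mon w - (lc i)^-1 *: (mon m * G i)).
  rewrite linearB linearZ /= -[LHS]subr0 => /addrI /oppr_inj /eqP.
  by rewrite eq_sym scaler_eq0 invr_eq0 (negbTE (lc_neq0 Ai)) => /eqP.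
rewrite [LHS]ext_mon /= red_w [in LHS]def_w [in RHS]def_w.
apply: eq_linspan (lead_tail m Ai) => _ [v [v_lev _] ->].
by rewrite !ext_mon; apply: nf_fuel; rewrite ?def_w.
Qed.

Hypothesis all_confluent : forall i j, A i -> A j -> confluent i j.

(** Any other step at the same monomial differs from the chosen one by an
    S-pair, which is killed by induction on [lev]. *)
Lemma reduce_multiple i m : A i -> reduce (mon m * G i) = 0.
Proof.
have [n] := ubnP (lev (mmul m (lead i))).
elim: n => // n IH in i m *; rewrite ltnS => le_n Ai.
case def_r: (sval (redexP (mmul m (lead i)))) => [[j m']|]; last first.
  have := svalP (redexP (mmul m (lead i))); rewrite def_r => irr_w.
  by exfalso; apply: irr_w; exists i, m.
have red_j := reduce_redex def_r.
have [Aj eq_w] : A j /\ mmul m (lead i) = mmul m' (lead j).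
  by have := svalP (redexP (mmul m (lead i))); rewrite def_r.
have : reduce (Spair i m j m') = 0.
  apply: linspan_kernel (all_confluent Ai Aj eq_w) => _ [l [v [Al v_lev ->]]].
  exact: IH (leq_trans v_lev le_n) Al.
rewrite linearB 2!linearZ_LR red_j scaler0 subr0 => /eqP.
by rewrite scaler_eq0 invr_eq0 (negbTE (lc_neq0 Ai)) => /eqP.
Qed.

(** [reduce] vanishes on the ideal and is the identity on combinations of
    irreducible monomials. *)
Lemma ideal_irred_eq0 f :
  linspan multiple f -> linspan (mons (fun w => ~ reducible w)) f -> f = 0.
Proof.
move=> fI f_irr; rewrite -(reduce_irred f_irr).
by apply: linspan_kernel fI => _ [i [m [Ai ->]]]; exact: reduce_multiple.
Qed.

End Groebner.

Section Confluence.
Variables (k : fieldType) (S : comAlgType k) (mon : monom -> S).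
Hypothesis monM : forall a b, mon (mmul a b) = mon a * mon b.
Variables (A : pred nat) (G : nat -> S) (lead : nat -> monom) (lc : nat -> k).
Variables (lev deg : monom -> nat).
Hypothesis lc_neq0 : forall i, A i -> lc i != 0.
Hypothesis tailP : forall i, A i ->
  linspan (mons mon (below lev deg (lead i))) (G i - lc i *: mon (lead i)).

Lemma tail_low_multiple u i j : A i -> A j ->
  linspan (low_multiple mon A G lead lev
          (lev (mmul u (mmul (lead i) (lead j)))))
       (mon u * ((G i - lc i *: mon (lead i)) * G j)).
Proof.
move=> Ai Aj; elim: (tailP Ai) => [|a f v [t tb ->] _ IH].
  by rewrite mul0r mulr0; exact: linspan0.
rewrite mulrDl mulrDr -scalerAl -scalerAr; apply: linspan_cons => //.
exists j, (mmul u t); split=> //; last by rewrite monM mulrA.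
have [+ _] := tb (mmul u (lead j)).
suff E (a1 a2 a3 : monom) : mmul (mmul a1 a2) a3 = mmul (mmul a1 a3) a2.
  by rewrite (E u (lead j) t) (E u (lead j) (lead i)) (mulmA u).
by rewrite -(mulmA a1 a2) (mulmC a2) mulmA.
Qed.

(** Buchberger's first criterion: if [G i = l_i + t_i] and [G j = l_j + t_j]
    with coprime leading terms, then [l_j * G i - l_i * G j] equals
    [t_i * G j - t_j * G i], and both products are below [l_i * l_j]. *)
Lemma coprime_confluent i j : A i -> A j ->
  (forall m m', mmul m (lead i) = mmul m' (lead j) ->
     exists u, m = mmul u (lead j) /\ m' = mmul u (lead i)) ->
  confluent mon A G lead lc lev i j.
Proof.
move=> Ai Aj copr m m' /copr[u [-> ->]] {m m' copr}.
have -> : Spair mon G lc i (mmul u (lead j)) j (mmul u (lead i))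
  = ((lc i)^-1 * (lc j)^-1) *:
    (mon u * ((G i - lc i *: mon (lead i)) * G j)
     - mon u * ((G j - lc j *: mon (lead j)) * G i)).
  have Ei : mon u * mon (lead i) * G j
      = (lc i)^-1 *: (mon u * (G i * G j)
                      - mon u * ((G i - lc i *: mon (lead i)) * G j)).
    rewrite -mulrBr -mulrBl opprB addrC addrNK -scalerAl -scalerAr scalerA.
    by rewrite mulVf ?lc_neq0 // scale1r mulrA.
  have Ej : mon u * mon (lead j) * G i
      = (lc j)^-1 *: (mon u * (G j * G i)
                      - mon u * ((G j - lc j *: mon (lead j)) * G i)).
    rewrite -mulrBr -mulrBl opprB addrC addrNK -scalerAl -scalerAr scalerA.
    by rewrite mulVf ?lc_neq0 // scale1r mulrA.
  rewrite /Spair !monM Ei Ej !scalerA (mulrC (lc j)^-1) -scalerBr.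
  by congr (_ *: _); rewrite (mulrC (G j) (G i)) opprB addrC addrA subrK.
apply/linspanZ/linspanB; rewrite -mulmA (mulmC (lead j)); first exact: tail_low_multiple.
by rewrite (mulmC (lead i)); exact: tail_low_multiple.
Qed.

End Confluence.

(** * A syzygy of the quadrics *)

Section FoldedSums.
Variable V : zmodType.

(** Pairing [i] with [n - i]; the middle term is kept apart because halving is
    not available in characteristic 2. *)
Lemma fold_sum (n : nat) (F : nat -> V) :
  \sum_(0 <= i < n.+1) F i
  = \sum_(0 <= i < n.+1 | (2 * i < n)%N) (F i + F (n - i)%N)
    + (if (2 %| n)%N then F (n %/ 2)%N else 0).
Proof.
rewrite (bigID (fun i => 2 * i < n)%N) /= big_split /= -addrA; congr (_ + _).
rewrite (bigID (fun i => 2 * i == n)%N) /= addrC; congr (_ + _).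
  rewrite [RHS]big_nat_rev /= big_nat_cond [RHS]big_nat_cond; apply: eq_big => i.
    by apply/idP/idP; lia.
  by move=> Hi; congr (F _); lia.
case: ifP => n2; last by rewrite big1_seq // => i Hi; lia.
rewrite big_mkcond (bigD1_seq (n %/ 2)%N) ?mem_index_iota ?iota_uniq //=; last lia.
rewrite ifT; last lia.
by rewrite big1 ?addr0 // => i Hi; rewrite ifF //; lia.
Qed.

(** The condition [i + a + b = N] is written inside a cube so that the three
    indices can be permuted freely. *)
Definition triple_sum (N : nat) (F : nat -> nat -> nat -> V) : V :=
  \sum_(0 <= i < N.+1) \sum_(0 <= a < N.+1) \sum_(0 <= b < N.+1)
    (if (i + a + b == N)%N then F i a b else 0).

Lemma triple_sumC12 N F :
  triple_sum N F = triple_sum N (fun i a b => F a i b).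
Proof.
rewrite /triple_sum exchange_big /=; apply: eq_bigr => i _; apply: eq_bigr => a _.
by apply: eq_bigr => b _; rewrite (addnC a).
Qed.

Lemma triple_sumC23 N F :
  triple_sum N F = triple_sum N (fun i a b => F i b a).
Proof.
rewrite /triple_sum; apply: eq_bigr => i _.
rewrite exchange_big /=; apply: eq_bigr => a _.
by apply: eq_bigr => b _; rewrite addnAC.
Qed.

Lemma eq_triple_sum N F F' :
  (forall i a b, (i + a + b = N)%N -> F i a b = F' i a b) ->
  triple_sum N F = triple_sum N F'.
Proof.
move=> eqF; apply: eq_bigr => i _; apply: eq_bigr => a _; apply: eq_bigr => b _.
by case: eqP => // /eqF.
Qed.

Lemma triple_sumB N F F' :
  triple_sum N (fun i a b => F i a b - F' i a b)
  = triple_sum N F - triple_sum N F'.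
Proof.
rewrite /triple_sum -sumrB; apply: eq_bigr => i _.
rewrite -sumrB; apply: eq_bigr => a _; rewrite -sumrB; apply: eq_bigr => b _.
by case: ifP; rewrite ?subr0.
Qed.

Lemma triple_sumE N F :
  \sum_(0 <= i < N.+1) \sum_(0 <= a < (N - i).+1) F i a (N - i - a)%N
  = triple_sum N F.
Proof.
apply: eq_big_nat => i /andP[_ iN].
have le_n : ((N - i).+1 <= N.+1)%N by rewrite ltnS leq_subr.
rewrite (big_nat_widen _ _ _ _ _ le_n) /= big_mkcond /=.
apply: eq_big_nat => a /andP[_ aN]; case: ifP => ai; last first.
  by rewrite big1_seq // => b _; case: eqP => //; lia.
rewrite (bigD1_seq (N - i - a)%N) ?mem_index_iota ?iota_uniq //=; last lia.
have -> : (i + a + (N - i - a) == N)%N by apply/eqP; lia.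
by rewrite big1 ?addr0 // => b /eqP Hb; case: eqP => //; lia.
Qed.

End FoldedSums.

Section Syzygy.
Variables (k : fieldType) (c : k).
Hypothesis cc : c ^+ 2 + c = 1.

(** The explicit cofactor [e] lets [ring] prove identities that hold only modulo
    the relation between [c] and 1. *)
Let reduce_c (e l r : k) : l - r = e * (c ^+ 2 + c - 1) -> l = r.
Proof. by rewrite cc subrr mulr0 => /subr0_eq. Qed.

Lemma five_neq0 : 5%N \notin [pchar k] -> 5%:R != 0 :> k.
Proof. by rewrite inE. Qed.

Lemma two_sub_c_neq0 : 5%N \notin [pchar k] -> 2 - c != 0.
Proof.
move=> char5; apply: contra_neq (five_neq0 char5) => c0.
have -> : 5%:R = (2 - c) * (3 + c) + (c ^+ 2 + c - 1) by ring.
by rewrite c0 cc mul0r subrr addr0.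
Qed.

Lemma three_add_c_neq0 : 5%N \notin [pchar k] -> 3 + c != 0.
Proof.
move=> char5; apply: contra_neq (five_neq0 char5) => c0.
have -> : 5%:R = (2 - c) * (3 + c) + (c ^+ 2 + c - 1) by ring.
by rewrite c0 cc mulr0 subrr addr0.
Qed.

Lemma one_add_2c_neq0 : 5%N \notin [pchar k] -> 1 + 2 * c != 0.
Proof.
move=> char5; apply: contra_neq (five_neq0 char5) => c0.
have -> : 5%:R = (1 + 2 * c) ^+ 2 - 4 * (c ^+ 2 + c - 1) by ring.
by rewrite c0 cc expr0n subrr mulr0 subr0.
Qed.

Lemma c_neq0 : c != 0.
Proof.
apply/eqP => c0; move: cc; rewrite c0 expr0n addr0 => /eqP.
by rewrite eq_sym oner_eq0.
Qed.

(** The analogue of [sin(2 pi j/5) / sin(2 pi/5)]: with [s c] in the role of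
    [2 cos(2 pi j/5)], the next lemmas are addition formulas for sines and
    cosines.  Subscripts are natural numbers modulo 5, so [4 * j] stands for
    [- j]. *)
Definition dcoef (j : nat) : k := nth 0 [:: 0; 1; c; - c; - 1] (j %% 5)%N.

Lemma eq_dcoef i j : i = j %[mod 5] -> dcoef i = dcoef j.
Proof. by rewrite /dcoef => ->. Qed.

Lemma eq_s i j : i = j %[mod 5] -> s c i = s c j.
Proof. by rewrite /s => ->. Qed.

(** [sin(x + y) + sin(x - y) = 2 sin x cos y] at [x = 2 pi/5]. *)
Lemma dcoef_pair j : dcoef (1 + j) + dcoef (1 + 4 * j) = s c j.
Proof using Type.
rewrite -(@eq_dcoef (1 + j %% 5) (1 + j)); last lia.
rewrite -(@eq_dcoef (1 + 4 * (j %% 5)) (1 + 4 * j)); last lia.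
rewrite -(@eq_s (j %% 5) j); last lia.
case: (j %% 5)%N (ltn_pmod j (isT : 0 < 5)%N) => [|[|[|[|[|//]]]]] _.
all: by rewrite /dcoef /s /=; ring.
Qed.

(** [- 4 sin x sin y = 2 cos(x + y) - 2 cos(x - y)]; the factor [3 + c] is
    [4 sin(2 pi/5)^2]. *)
Lemma dcoef_mul p q : - (3 + c) * (dcoef p * dcoef q) = s c (p + q) - s c (p + 4 * q).
Proof.
rewrite -(@eq_dcoef (p %% 5) p) -?(@eq_dcoef (q %% 5) q); [|lia..].
rewrite -(@eq_s (p %% 5 + q %% 5) (p + q)); last lia.
rewrite -(@eq_s (p %% 5 + 4 * (q %% 5)) (p + 4 * q)); last lia.
case: (p %% 5)%N (ltn_pmod p (isT : 0 < 5)%N) => [|[|[|[|[|//]]]]] _;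
case: (q %% 5)%N (ltn_pmod q (isT : 0 < 5)%N) => [|[|[|[|[|//]]]]] _.
all: rewrite /dcoef /s /=.
all: first [ ring | by apply: (@reduce_c 1); ring | by apply: (@reduce_c (- 1)); ring
  | by apply: (@reduce_c (c + 2)); ring | by apply: (@reduce_c (- (c + 2))); ring ].
Qed.

(** [sin(3i + j) + sin(3j + i) = 2 sin(2i + 2j) cos(i - j)] in units of
    [2 pi/5], the cosine being expanded by [dcoef_pair]. *)
Lemma dcoef_double i j :
  dcoef (3 * i + j) + dcoef (3 * j + i)
  = dcoef (2 * i + 2 * j) * (dcoef (1 + j + 4 * i) + dcoef (1 + i + 4 * j)).
Proof.
rewrite -(@eq_dcoef (3 * (i %% 5) + j %% 5) (3 * i + j)); last lia.
rewrite -(@eq_dcoef (3 * (j %% 5) + i %% 5) (3 * j + i)); last lia.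
rewrite -(@eq_dcoef (2 * (i %% 5) + 2 * (j %% 5)) (2 * i + 2 * j)); last lia.
rewrite -(@eq_dcoef (1 + j %% 5 + 4 * (i %% 5)) (1 + j + 4 * i)); last lia.
rewrite -(@eq_dcoef (1 + i %% 5 + 4 * (j %% 5)) (1 + i + 4 * j)); last lia.
case: (i %% 5)%N (ltn_pmod i (isT : 0 < 5)%N) => [|[|[|[|[|//]]]]] _;
case: (j %% 5)%N (ltn_pmod j (isT : 0 < 5)%N) => [|[|[|[|[|//]]]]] _.
all: rewrite /dcoef /=.
all: first [ ring | by apply: (@reduce_c 1); ring | by apply: (@reduce_c (- 1)); ring
  | by apply: (@reduce_c 2); ring | by apply: (@reduce_c (- 2)); ring
  | by apply: (@reduce_c c); ring | by apply: (@reduce_c (- c)); ring ].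
Qed.

End Syzygy.

Section Quadrics.
Variables (k : fieldType) (c : k).
Hypothesis cc : c ^+ 2 + c = 1.
Hypothesis char5 : 5%N \notin [pchar k].
Variables (S : comAlgType k) (X : nat -> S).
Local Notation d := (dcoef c).

(** The polynomial [g_n] for arbitrary elements [X i] of an algebra. *)
Definition quadric (n : nat) : S :=
  (s c n - c) *: X n
  + \sum_(1 <= i < n | (2 * i < n)%N) s c (n - 2 * i) *: (X i * X (n - i))
  + (if (2 %| n)%N then X (n %/ 2)%N ^+ 2 else 0).

Definition xval (i : nat) : S := if i is 0 then 1 else X i.
Local Notation y := xval.

(** [g_n] as a full convolution of [x_0 = 1, x_1, x_2, ...]: each unordered pair
    [i, n - i] occurs twice, and [s_n x_n] is its pair [0, n]. *)
Definition polarized (n : nat) : S :=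
  \sum_(0 <= i < n.+1) d (1 + (n - i) + 4 * i) *: (y i * y (n - i)) - c *: y n.

Lemma polarizedE n : (0 < n)%N -> polarized n = quadric n.
Proof.
move=> n0; rewrite /polarized fold_sum /quadric.
have -> : (if (2 %| n)%N then X (n %/ 2)%N ^+ 2 else 0)
    = (if (2 %| n)%N then
      d (1 + (n - n %/ 2) + 4 * (n %/ 2))
        *: (y (n %/ 2) * y (n - n %/ 2)%N) else 0).
  case: ifP => // n2; rewrite (_ : n - n %/ 2 = n %/ 2)%N; last lia.
  rewrite (@eq_dcoef _ _ _ 1); last lia.
  by rewrite /dcoef /= scale1r; case: (n %/ 2)%N (ltac:(lia) : (0 < n %/ 2)%N).
rewrite [LHS]addrAC; apply: (congr2 +%R); last by [].
rewrite big_mkcond /= big_nat_recl //= muln0 n0 subn0 [LHS]addrAC; apply: (congr2 +%R).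
  rewrite subnn mulr1 mul1r -scalerDl -scalerBl; congr ((_ - _) *: _); last first.
    by case: n n0.
  rewrite -dcoef_pair; congr (_ + _); apply: eq_dcoef; lia.
rewrite [RHS]big_mkcond /= big_add1 big_nat_cond [RHS]big_nat_cond.
case: n n0 => // n _.
rewrite [in RHS]/= -big_nat_cond -[RHS]big_nat_cond big_nat_recr //=.
rewrite [X in _ + X]ifF ?addr0; last lia.
apply: eq_big_nat => i /andP[_ ilt]; case: ifP => // i2.
rewrite (_ : n.+1 - (n.+1 - i.+1) = i.+1)%N; last lia.
rewrite (mulrC (y (n.+1 - i.+1))) -scalerDl.
have -> : y (n.+1 - i.+1) = X (n.+1 - i.+1)%N.
  by case: (n.+1 - i.+1)%N (ltac:(lia) : (0 < n.+1 - i.+1)%N).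
congr (_ *: _); rewrite -dcoef_pair; congr (_ + _); apply: eq_dcoef; lia.
Qed.

Lemma triple_sumZ N (e : k) (F : nat -> nat -> nat -> S) :
  e *: triple_sum N F = triple_sum N (fun i a b => e *: F i a b).
Proof.
rewrite /triple_sum scaler_sumr; apply: eq_bigr => i _.
rewrite scaler_sumr; apply: eq_bigr => a _.
rewrite scaler_sumr; apply: eq_bigr => b _.
by case: ifP; rewrite ?scaler0.
Qed.

(** By [dcoef_mul], [- (3 + c)] times the coefficient is a difference of two
    cosines, each depending on two of the three indices [i], [a], [b], in the
    same way up to a permutation of the indices; the monomial being symmetric,
    the two sums cancel. *)
Lemma cubic_part_eq0 N :
  \sum_(0 <= i < N.+1) \sum_(0 <= a < (N - i).+1)
    (d (N + 2 * i) * d (1 + (N - i - a) + 4 * a))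
      *: (y i * (y a * y (N - i - a))) = 0.
Proof.
rewrite (@triple_sumE _ N (fun i a b =>
  (d (N + 2 * i) * d (1 + b + 4 * a)) *: (y i * (y a * y b)))).
set T := triple_sum _ _.
suff : - (3 + c) *: T = 0.
  by move/eqP; rewrite scaler_eq0 oppr_eq0 (negbTE (three_add_c_neq0 cc char5)) => /eqP.
pose F i a b := s c (3 * i + 2 * b + 1) *: (y i * (y a * y b)).
pose F' i a b := s c (3 * a + 2 * i + 1) *: (y i * (y a * y b)).
have s4 j : s c (4 * j) = s c j.
  by rewrite -!dcoef_pair addrC; congr (_ + _); apply: eq_dcoef; lia.
rewrite triple_sumZ (@eq_triple_sum _ _ _ (fun i a b => F i a b - F' i a b)).
  rewrite triple_sumB (triple_sumC12 N F') (triple_sumC23 N (fun i a b => F' a i b)).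
  apply/eqP; rewrite subr_eq0; apply/eqP; apply: eq_triple_sum => i a b _.
  by rewrite /F /F' [in RHS]mulrCA (mulrC (y b)).
move=> i a b abN; rewrite /F /F' scalerA dcoef_mul // -scalerBl; congr ((_ - _) *: _).
  by apply: eq_s; lia.
by rewrite -[RHS]s4; apply: eq_s; lia.
Qed.

Lemma quadratic_part_eq0 N :
  \sum_(0 <= i < N.+1)
    (c * d (2 * N) * d (1 + (N - i) + 4 * i) - c * d (N + 2 * i))
      *: (y i * y (N - i)) = 0.
Proof.
rewrite fold_sum big_nat_cond big1 ?add0r => [|i /andP[/andP[_ iN] i2]].
  case: ifP => // N2.
  rewrite (_ : _ - _ = 0) ?scale0r // (@eq_dcoef _ _ (1 + _ + _)%N 1); last lia.
  by rewrite (@eq_dcoef _ _ (2 * N) (N + 2 * (N %/ 2))) /dcoef /= ?mulr1 ?subrr //; lia.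
have [j jE] : exists j, j = (N - i)%N by exists (N - i)%N.
have jN : (N - j = i)%N by lia.
have NE : (N = i + j)%N by lia.
rewrite -jE jN (mulrC (y j)) -scalerDl (_ : _ + _ = 0) ?scale0r //.
have := dcoef_double cc i j.
rewrite (@eq_dcoef _ _ (3 * i + j) (N + 2 * i)) ?(@eq_dcoef _ _ (3 * j + i) (N + 2 * j)); [|lia..].
rewrite (_ : 2 * i + 2 * j = 2 * N)%N; last lia.
move=> E; rewrite addrACA -opprD -!mulrDr E; ring.
Qed.

(** Expanding each [g] by [polarized], the cubic terms cancel among themselves,
    the quadratic terms of the sum cancel those of [c d(2N) g_N], and what is
    left is [(1 - c - c^2) d(2N) x_N]. *)
Lemma syzygy N : (0 < N)%N ->
  \sum_(0 <= i < N) d (N + 2 * i) *: (y i * quadric (N - i))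
    + (c * d (2 * N)) *: quadric N = 0.
Proof.
move=> N0.
have -> : \sum_(0 <= i < N) d (N + 2 * i) *: (y i * quadric (N - i))
  = - \sum_(0 <= i < N.+1) (c * d (N + 2 * i)) *: (y i * y (N - i))
    + ((1 - c) * d (2 * N)) *: y N.
  transitivity (\sum_(0 <= i < N.+1) d (N + 2 * i) *: (y i * polarized (N - i))
                + ((1 - c) * d (2 * N)) *: y N).
    (* The term [i = N] is the defect [1 - c] of [polarized] at 0. *)
    have pol0 : polarized 0 = (1 - c) *: 1.
      by rewrite /polarized big_nat1 /= mulr1 -scalerBl.
    rewrite big_nat_recr //= subnn pol0 -scalerAr mulr1 scalerA -addrA -scalerDl.
    rewrite (_ : _ * _ + _ = 0) ?scale0r ?addr0.
      by apply: eq_big_nat => i /andP[_ iN]; rewrite polarizedE //; lia.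
    have -> : d (N + 2 * N) = - d (2 * N).
      rewrite -(@eq_dcoef _ _ (3 * (N %% 5)) (N + 2 * N)); last lia.
      rewrite -(@eq_dcoef _ _ (2 * (N %% 5)) (2 * N)); last lia.
      case: (N %% 5)%N (ltn_pmod N (isT : 0 < 5)%N) => [|[|[|[|[|//]]]]] _;
        by rewrite /dcoef /=; ring.
    by rewrite /dcoef /=; ring.
  congr (_ + _); rewrite -[LHS]add0r -[X in X + _]oppr0 -[in X in X + _](cubic_part_eq0 N).
  rewrite -sumrN -big_split -sumrN /=; apply: eq_big_nat => i /andP[_ iN].
  rewrite /polarized mulrBr scalerBr -scalerAr scalerA (mulrC c) mulr_sumr scaler_sumr.
  rewrite addrA (_ : - _ + _ = 0) ?add0r //; apply/eqP; rewrite addrC subr_eq0.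
  apply/eqP; apply: eq_bigr => a _.
  by rewrite -scalerAr scalerA.
have := quadratic_part_eq0 N; under eq_bigr do rewrite scalerBl.
rewrite sumrB => /subr0_eq <-.
rewrite -(polarizedE N0) /polarized scalerBr scaler_sumr scalerA.
under [X in _ + (X - _)]eq_bigr do rewrite scalerA.
rewrite addrACA addNr add0r -scalerBl (_ : _ - _ = 0) ?scale0r //.
transitivity ((1 - (c ^+ 2 + c)) * d (2 * N)); first by ring.
by rewrite cc subrr mul0r.
Qed.

End Quadrics.

(** * Weights of monomials *)

(** The monomial [x_i], with the convention [x_0 = 1]. *)
Definition xmon (i : nat) : monom := if i is j.+1 then ucm j else mone.

Definition weight (h : nat -> nat) (a : monom) : nat :=
  (\sum_(j <- finsupp a) h j.+1 * a j)%N.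

Lemma weight_supp (h : nat -> nat) (E : {fset nat}) (a : monom) :
  finsupp a `<=` E -> weight h a = (\sum_(j <- E) h j.+1 * a j)%N.
Proof.
move=> aE; apply: big_fset_incl => // j _ ja.
by rewrite (_ : a j = 0%N) ?muln0 //; apply/eqP; rewrite cmE_eq0.
Qed.

Lemma weightM h (a b : monom) :
  weight h (mmul a b) = (weight h a + weight h b)%N.
Proof.
rewrite (@weight_supp h (finsupp a `|` finsupp b)) ?mdomD //.
rewrite (@weight_supp h (finsupp a `|` finsupp b) a) ?fsubsetUl //.
rewrite (@weight_supp h (finsupp a `|` finsupp b) b) ?fsubsetUr //.
by rewrite -big_split /=; apply: eq_bigr => j _; rewrite cmM mulnDr.
Qed.

Lemma weight_xmon h i : h 0%N = 0%N -> weight h (xmon i) = h i.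
Proof.
case: i => [|i] h0; rewrite /weight /= ?mdom1 ?big_seq_fset0 ?h0 //.
by rewrite mdomU big_seq_fset1 cmUU muln1.
Qed.

Lemma wtE a : wt a = weight id a.
Proof. by []. Qed.

Definition sm : monom -> nat := weight (fun i => i ^ 2)%N.

Lemma sm_le_wt2 a : (sm a <= wt a ^ 2)%N.
Proof.
rewrite wtE /sm /weight expnS expn1 big_distrr /= big_seq [leqRHS]big_seq.
apply: leq_sum => j ja; rewrite expnS expn1 -mulnA leq_mul2r; apply/orP; right.
rewrite [leqRHS](big_fsetD1 j ja) /=; apply: leq_trans (leq_addr _ _).
by rewrite leq_pmulr // lt0n cmE_neq0.
Qed.

Lemma wtM a b : wt (mmul a b) = (wt a + wt b)%N.
Proof. by rewrite !wtE weightM. Qed.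

Lemma smM a b : sm (mmul a b) = (sm a + sm b)%N.
Proof. exact: weightM. Qed.

Lemma wt_xmon i : wt (xmon i) = i.
Proof. by rewrite wtE weight_xmon. Qed.

Lemma sm_xmon i : sm (xmon i) = (i ^ 2)%N.
Proof. exact: weight_xmon. Qed.

(** Among monomials of one weight it decreases as the square moment increases,
    and it is a natural number, on which reduction can terminate. *)
Definition colevel (a : monom) : nat := (wt a ^ 2 - sm a)%N.

Lemma colevel_lt a b : wt a = wt b -> (sm b < sm a)%N ->
  (colevel a < colevel b)%N.
Proof.
move=> wab; rewrite /colevel wab => sm_ba.
by have := sm_le_wt2 a; rewrite wab => sm_a; apply: ltn_sub2l => //; exact: leq_trans sm_a.
Qed.

Lemma below_sm l t : wt t = wt l -> (sm t < sm l)%N -> below sm wt l t.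
Proof. by move=> wtl smtl m; rewrite !smM !wtM wtl ltn_add2l. Qed.

Lemma below_colevel l t : wt t = wt l -> (sm l < sm t)%N -> below colevel wt l t.
Proof.
move=> wtl smtl m; split; last by rewrite !wtM wtl.
by apply: colevel_lt; rewrite ?wtM ?wtl // !smM ltn_add2l.
Qed.

(** * Divisibility of monomials *)

Lemma monom_ext (a b : monom) : (forall i, a i = b i) -> a = b.
Proof. by move=> ab; apply/eqP/cmP. Qed.

Lemma coprime_cofactors (l1 l2 m m' : monom) :
  (forall i, l1 i = 0%N \/ l2 i = 0%N) ->
  mmul m l1 = mmul m' l2 -> exists u, m = mmul u l2 /\ m' = mmul u l1.
Proof.
move=> copr E; exists (divcm m l2).
have Ei i : (m i + l1 i = m' i + l2 i)%N by rewrite -!cmM E.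
by split; apply: monom_ext => i; rewrite cmM divcmE;
  move: (Ei i) (copr i); lia.
Qed.

Lemma monom_mulIr (l m m' : monom) : mmul m l = mmul m' l -> m = m'.
Proof.
move=> E; apply: monom_ext => i; apply: (@addIn (l i)).
by rewrite -!cmM E.
Qed.

Lemma xmon_neq i j : (0 < i)%N -> i != j -> forall l, xmon i l = 0%N \/ xmon j l = 0%N.
Proof.
case: i j => // i [|j] _ ij l; rewrite /= !(cm1, cmU); first by right.
by move: ij; rewrite eqSS; case: (i =P l) => [->|]; case: (j =P l) => [->|] //; lia.
Qed.

(** The term of [g_n] of smallest square moment, hence its leading monomial for
    the order of which [Q] is the set of standard monomials. *)
Definition middle (n : nat) : monom := mmul (xmon (n %/ 2)) (xmon (n - n %/ 2)).

Lemma wt_middle n : wt (middle n) = n.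
Proof. by rewrite wtM !wt_xmon; lia. Qed.

Lemma xmonE i l : (0 < i)%N -> xmon i l = (i.-1 == l) :> nat.
Proof. by case: i => // i _; rewrite cmU. Qed.

Lemma monom_dvd (a w : monom) : (forall l, a l <= w l)%N ->
  w = mmul (divcm w a) a.
Proof. by move=> aw; apply: monom_ext => l; rewrite cmM divcmE subnK. Qed.

Definition at_least2 (n : nat) : bool := (2 <= n)%N.

Lemma mem_P_irred n w :
  w \in P n <-> ~ reducible D xmon w /\ wt w = n.
Proof.
rewrite mem_P; split=> -[].
  move=> wn Pw; split=> // -[i [m [Di def_w]]].
  have i0 : (0 < i)%N by move: Di; rewrite /D; lia.
  have : expo w i = 0%N by apply: Pw => //; move: Di; rewrite /D; lia.
  by rewrite /expo def_w cmM xmonE // eqxx; lia.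
move=> irr_w wn; split=> // i i0 i14; apply/eqP/negPn/negP => wi.
apply: irr_w; exists i, (divcm w (xmon i)); split; first by rewrite /D; lia.
apply: monom_dvd => l; rewrite xmonE //.
by move: wi; rewrite /expo; case: (i.-1 =P l) => [<-|]; lia.
Qed.

Lemma mem_Q_irred n w :
  w \in Q n <-> ~ reducible at_least2 middle w /\ wt w = n.
Proof.
rewrite mem_Q; split=> -[].
  move=> wn Qw; split=> // -[i [m [i2 def_w]]].
  rewrite /at_least2 in i2.
  have p0 : (0 < i %/ 2)%N by lia.
  have [le1 next0] := Qw _ p0; move: le1 next0.
  rewrite /expo def_w /middle !cmM !xmonE //; [|lia..].
  rewrite eqxx; have [->|ne] := eqVneq (i - i %/ 2)%N (i %/ 2)%N.
    by rewrite eqxx; lia.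
  by rewrite (_ : i - i %/ 2 = (i %/ 2).+1)%N ?eqxx /=; lia.
move=> irr_w wn; split=> // i i0; split.
  apply/contraT; rewrite -ltnNge => wi; exfalso; apply: irr_w.
  exists (2 * i)%N, (divcm w (middle (2 * i))); split; first by rewrite /at_least2; lia.
  apply: monom_dvd => l; rewrite /middle cmM !xmonE; [|lia..].
  rewrite (_ : 2 * i - 2 * i %/ 2 = i)%N; last lia.
  rewrite (_ : 2 * i %/ 2 = i)%N; last lia.
  by move: wi; rewrite /expo; case: (i.-1 =P l) => [<-|]; lia.
move=> /eqP wi; apply/eqP/contraT => wi1; exfalso; apply: irr_w.
exists (2 * i).+1, (divcm w (middle (2 * i).+1)); split; first by rewrite /at_least2; lia.
apply: monom_dvd => l; rewrite /middle cmM !xmonE; [|lia..].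
rewrite (_ : (2 * i).+1 - (2 * i).+1 %/ 2 = i.+1)%N; last lia.
rewrite (_ : (2 * i).+1 %/ 2 = i)%N; last lia.
move: wi wi1; rewrite /expo /= => wi wi1.
case: (i.-1 =P l) => [<-|_]; first by rewrite (_ : (i == i.-1) = false) /=; lia.
by case: (i =P l) => [<-|_] /=; lia.
Qed.

Lemma xmon_le1 i l : (xmon i l <= 1)%N.
Proof.
case: i => [|i]; first by change ((mone : monom) l <= 1)%N; rewrite (cm1 l).
by rewrite (xmonE l (ltn0Sn i)); case: (i == l).
Qed.

(** A name for the exponents of [xmon], so that they can be generalized all at
    once before an arithmetic decision procedure. *)
Definition expx (i l : nat) : nat := xmon i l.

Lemma expx_disjoint p q l : (0 < p)%N -> p != q -> (expx p l + expx q l <= 1)%N.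
Proof.
move=> p0 pq; have := xmon_neq p0 pq l; have := xmon_le1 p l; have := xmon_le1 q l.
rewrite -!/(expx _ _); move: expx => f; lia.
Qed.

Lemma middleE n l : middle n l = (expx (n %/ 2) l + expx (n - n %/ 2) l)%N.
Proof. exact: cmM. Qed.

Lemma middle_even p l : middle (2 * p) l = (expx p l + expx p l)%N.
Proof.
have h1 : (2 * p %/ 2 = p)%N by lia.
have h2 : (2 * p - p = p)%N by lia.
by rewrite middleE h1 h2.
Qed.

Lemma middle_odd p l : middle (2 * p).+1 l = (expx p l + expx p.+1 l)%N.
Proof.
have h1 : ((2 * p).+1 %/ 2 = p)%N by lia.
have h2 : ((2 * p).+1 - p = p.+1)%N by lia.
by rewrite middleE h1 h2.
Qed.

(** The three ways in which the leading monomials of [g_i] and [g_j] with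
    [i < j] share a variable.  With [p = i./2], their least common multiple is
    [x_q] times the first and [x_p] times the second, so it has weight
    [i + q = j + p]. *)
Definition overlapping (p i j q : nat) : Prop :=
  [\/ [/\ i = 2 * p, j = (2 * p).+1 & q = p.+1],
      [/\ i = (2 * p).+1, j = 2 * p.+1 & q = p.+1]
    | [/\ i = (2 * p).+1, j = (2 * p.+1).+1 & q = p.+2]]%N.

Lemma overlap_cofactors p i j q m m' : (0 < p)%N -> overlapping p i j q ->
  mmul m (middle i) = mmul m' (middle j) ->
  exists u, m = mmul u (xmon q) /\ m' = mmul u (xmon p).
Proof.
move=> p0 ov E.
have pq : p != q by case: ov => -[_ _ ->]; lia.
have Em l : (m l + expx p l = m' l + expx q l)%N.
  have := congr1 (fun w : monom => w l) E; rewrite 2!cmM.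
  case: ov => -[-> -> ->]; rewrite ?middle_even ?middle_odd.
  - by move: expx (m l) (m' l) => f a b; clear; lia.
  - by move: expx (m l) (m' l) => f a b; clear; lia.
  - by move: expx (m l) (m' l) => f a b; clear; lia.
apply: coprime_cofactors; first by move=> l; case: (xmon_neq p0 pq l); [left | right].
by apply: monom_ext => l; rewrite 2!cmM; exact: Em.
Qed.

Lemma middle_coprime_or_overlap i j : (2 <= i)%N -> (i < j)%N ->
  (forall l, middle i l = 0%N \/ middle j l = 0%N) \/
  (exists q, overlapping (i %/ 2) i j q).
Proof.
move=> i2 ij; pose p := (i %/ 2)%N; pose r := (j %/ 2)%N.
have [|no1] := boolP ((i == 2 * p) && (j == (2 * p).+1))%N.
  by case/andP=> /eqP ip /eqP jp; right; exists p.+1; apply: Or31.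
have [|no2] := boolP ((i == (2 * p).+1) && (j == 2 * p.+1))%N.
  by case/andP=> /eqP ip /eqP jp; right; exists p.+1; apply: Or32.
have [|no3] := boolP ((i == (2 * p).+1) && (j == (2 * p.+1).+1))%N.
  by case/andP=> /eqP ip /eqP jp; right; exists p.+2; apply: Or33.
left=> l; rewrite !middleE -/p -/r.
have p0 : (0 < p)%N by rewrite /p; lia.
have ip0 : (0 < i - p)%N by rewrite /p; lia.
have d1 := @expx_disjoint p r l p0 (ltac:(rewrite /p /r in no1 no2 no3 *; lia)).
have d2 := @expx_disjoint p (j - r)%N l p0 (ltac:(rewrite /p /r in no1 no2 no3 *; lia)).
have d3 := @expx_disjoint (i - p)%N r l ip0 (ltac:(rewrite /p /r in no1 no2 no3 *; lia)).
have d4 := @expx_disjoint (i - p)%N (j - r)%N l ip0 (ltac:(rewrite /p /r in no1 no2 no3 *; lia)).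
move: expx d1 d2 d3 d4 => f; move: (f p l) (f (i - p)%N l) (f r l) (f (j - r)%N l).
by clear; lia.
Qed.

(** * The two Groebner bases *)

Section Bases.
Variables (k : fieldType) (c : k).
Hypothesis cc : c ^+ 2 + c = 1.
Hypothesis char5 : 5%N \notin [pchar k].
Variables (S : comAlgType k) (mon : monom -> S).
Variable ext : (monom -> S) -> {linear S -> S}.
Hypothesis monM : forall a b, mon (mmul a b) = mon a * mon b.
Hypothesis mon1 : mon mone = 1.
Hypothesis ext_mon : forall F w, ext F (mon w) = F w.

Local Notation d := (dcoef c).
Definition var (i : nat) : S := mon (ucm i.-1).
Local Notation G := (quadric c var).
Local Notation y := (xval var).

Lemma yE i : y i = mon (xmon i).
Proof. by case: i. Qed.

Definition coef (n i : nat) : k :=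
  if i == 0%N then s c n - c else if (2 * i == n)%N then 1 else s c (n - 2 * i).

Lemma quadricE n : (0 < n)%N ->
  G n = \sum_(0 <= i < n | (2 * i <= n)%N) coef n i *: mon (mmul (xmon i) (xmon (n - i))).
Proof.
move=> n0; rewrite big_mkcond /= big_ltn //= ?muln0 ?leq0n subn0 /quadric -addrA.
apply: (congr2 +%R); first by rewrite mul1m; case: n n0.
have -> : (if (2 %| n)%N then var (n %/ 2)%N ^+ 2 else 0)
  = \sum_(1 <= i < n) (if (2 * i == n)%N then var i ^+ 2 else 0).
  case: ifP => n2.
    rewrite (bigD1_seq (n %/ 2)%N) ?mem_index_iota ?iota_uniq //=; last lia.
    rewrite ifT; last lia.
    by rewrite big1 ?addr0 // => i ni; rewrite ifF //; lia.
  by rewrite big1 // => i _; rewrite ifF //; lia.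
rewrite big_mkcond -big_split /=; apply: eq_big_nat => i /andP[i0 iN].
have vv : mon (mmul (xmon i) (xmon (n - i))) = var i * var (n - i).
  rewrite monM -!yE; case: i i0 iN => // i _ iN.
  by case: (n - i.+1)%N (ltac:(lia) : (0 < n - i.+1)%N).
rewrite vv /coef (_ : (i == 0%N) = false); last lia.
case: ltngtP => [i2|i2|i2]; rewrite ?addr0 //.
by rewrite add0r scale1r (_ : n - i = i)%N //; lia.
Qed.

Lemma quadric_tail (B : monom -> Prop) n i0 :
  (2 <= n)%N -> (2 * i0 <= n)%N ->
  (forall i, i != i0 -> (2 * i <= n)%N -> B (mmul (xmon i) (xmon (n - i)))) ->
  linspan (mons mon B) (G n - coef n i0 *: mon (mmul (xmon i0) (xmon (n - i0)))).
Proof.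
move=> n2 i0n HB; rewrite quadricE; last lia.
rewrite big_mkcond (bigD1_seq i0) ?mem_index_iota ?iota_uniq //=; last lia.
rewrite i0n addrAC subrr add0r; apply: linspan_sum => i ni; case: ifP => i2; last exact: linspan0.
by apply/linspanZ/linspan_gen; exists (mmul (xmon i) (xmon (n - i))) => //; apply: HB.
Qed.

(** ** The ideal *)

Definition ideal : S -> Prop := linspan (multiple mon D G).

Lemma ideal_mul m f : ideal f -> ideal (mon m * f).
Proof.
elim=> [|a u w [i [m' [Di ->]]] _ IH]; first by rewrite mulr0; exact: linspan0.
rewrite mulrDr -scalerAr; apply: linspan_cons => //.
by exists i, (mmul m m'); rewrite monM mulrA.
Qed.

Lemma ideal_gen n : D n -> ideal (G n).
Proof. by move=> Dn; apply: linspan_gen; exists n, mone; rewrite mon1 mul1r. Qed.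

Lemma quadric1 : G 1 = 0.
Proof. by rewrite /quadric big_geq // /s /= subrr scale0r !addr0. Qed.

(** The term [i = 0] of the syzygy at [n] and its last term combine to
    [(d_n + c d_{2n}) g_n]; when [n] is 1 or 4 modulo 5 the coefficient is
    [1 + c^2] up to sign, that is [2 - c]. *)
Lemma quadric_in_ideal n : (0 < n)%N -> ideal (G n).
Proof.
have [N] := ubnP n; elim: N => // N IH in n *; rewrite ltnS => nN n0.
have [Dn|nD] := boolP (D n); first exact: ideal_gen.
have [->|n1] := eqVneq n 1%N; first by rewrite quadric1; exact: linspan0.
have := syzygy cc char5 var n0; rewrite big_ltn //= addn0 subn0 mul1r.
rewrite addrAC -scalerDl => /eqP; rewrite addr_eq0 => /eqP E.
have c0 : d n + c * d (2 * n) != 0.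
  have n14 : (n %% 5 == 1)%N || (n %% 5 == 4)%N by move: nD; rewrite /D; lia.
  have F : 1 + c * c = 2 - c by rewrite -[2]/(1 + 1) -[X in 1 + X - c]cc; ring.
  case/orP: n14 => /eqP n5.
    rewrite (@eq_dcoef _ _ _ 1) ?(@eq_dcoef _ _ (2 * n) 2) /dcoef /= ?F ?two_sub_c_neq0 //; lia.
  rewrite (@eq_dcoef _ _ _ 4) ?(@eq_dcoef _ _ (2 * n) 3) /dcoef /=; [|lia..].
  by rewrite mulrN -opprD oppr_eq0 F two_sub_c_neq0.
rewrite -[G n]scale1r -(mulVf c0) -scalerA E; apply/linspanZ/linspanN.
rewrite big_nat_cond; apply: linspan_sum => i /andP[/andP[i0 iN] _].
by rewrite yE; apply/linspanZ/ideal_mul/IH; lia.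
Qed.

Lemma ideal_seqP f : (forall h, linspan (mons mon (fun=> True)) h) ->
  (exists r : seq (nat * S),
     all (fun p => D p.1) r /\ f = \sum_(p <- r) p.2 * G p.1) <-> ideal f.
Proof.
move=> mon_span; split=> [[r [/allP Dr ->]]|].
  rewrite big_seq; apply: linspan_sum => p /Dr Dp.
  elim: (mon_span p.2) => [|a u h [w _ ->] _ IH]; first by rewrite mul0r; exact: linspan0.
  rewrite mulrDl -scalerAl; apply: linspanD => //.
  by apply/linspanZ/ideal_mul/ideal_gen.
elim=> [|a u h [i [m [Di ->]]] _ [r [Dr ->]]]; first by exists [::]; rewrite big_nil.
by exists ((i, a *: mon m) :: r); rewrite /= Di big_cons scalerAl.
Qed.

Lemma linspan_monsP (A : {fset monom}) f :
  (exists a : A -> k, f = \sum_(t : A) a t *: mon (val t)) <->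
  linspan (mons mon (fun w => w \in A)) f.
Proof.
split=> [[a ->]|].
  apply: linspan_sum => t _; apply/linspanZ/linspan_gen.
  by exists (val t) => //; exact: fsvalP.
elim=> [|e u h [w wA ->] _ [a ->]].
  by exists (fun=> 0); rewrite big1 // => t _; rewrite scale0r.
exists (fun t => e * (t == [` wA])%:R + a t).
under [RHS]eq_bigr do rewrite scalerDl; rewrite big_split /=; congr (_ + _).
rewrite (bigD1 [` wA]) //= eqxx mulr1 big1 ?addr0 // => t /negbTE ->.
by rewrite mulr0 scale0r.
Qed.

Lemma ideal_at_least2 f : linspan (multiple mon at_least2 G) f <-> ideal f.
Proof.
split; apply: linspan_trans => _ [i [m [Hi ->]]].
  by apply/ideal_mul/quadric_in_ideal; move: Hi; rewrite /at_least2; lia.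
by apply: linspan_gen; exists i, m; split=> //; move: Hi; rewrite /D; case/andP.
Qed.

Lemma Spair_sym i m j m' (lc : nat -> k) :
  Spair mon G lc j m' i m = - Spair mon G lc i m j m'.
Proof. by rewrite /Spair opprB. Qed.

Lemma confluent_sym A lead lc lev i j :
  confluent mon A G lead lc lev i j -> confluent mon A G lead lc lev j i.
Proof. by move=> Cij m m' E; rewrite Spair_sym E; apply/linspanN/Cij. Qed.

Lemma confluent_diag A lead lc lev i : confluent mon A G lead lc lev i i.
Proof. by move=> m m' /monom_mulIr ->; rewrite /Spair subrr; exact: linspan0. Qed.

(** ** The basis P *)

Definition lcP (n : nat) : k := s c n - c.

Lemma lcP_neq0 n : D n -> lcP n != 0.
Proof.
rewrite /D => /andP[_ /or3P[] /eqP n5]; rewrite /lcP /s n5 /=.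
- exact: two_sub_c_neq0.
- by rewrite (_ : _ - _ = - (1 + 2 * c)) ?oppr_eq0 ?one_add_2c_neq0 //; ring.
- by rewrite (_ : _ - _ = - (1 + 2 * c)) ?oppr_eq0 ?one_add_2c_neq0 //; ring.
Qed.

Lemma tailP_P n : D n ->
  linspan (mons mon (below sm wt (xmon n))) (G n - lcP n *: mon (xmon n)).
Proof.
move=> Dn; have n2 : (2 <= n)%N by case/andP: Dn.
have := @quadric_tail (below sm wt (xmon n)) n 0 n2 isT.
rewrite subn0 mul1m; apply=> i i0 i2.
apply: below_sm; first by rewrite wtM !wt_xmon; lia.
by rewrite smM !sm_xmon; nia.
Qed.

Lemma confluent_P i j : D i -> D j -> confluent mon D G xmon lcP sm i j.
Proof.
move=> Di Dj; have [->|ij] := eqVneq i j; first exact: confluent_diag.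
apply: (coprime_confluent monM lcP_neq0 tailP_P) => // m m'.
by apply: coprime_cofactors; apply: xmon_neq => //; case/andP: Di; lia.
Qed.

Lemma linspan_P w : exists2 r,
  linspan (mons mon (fun u => u \in P (wt w))) r & ideal (mon w - r).
Proof.
have [r r_irr r_eq] := linspan_reduce monM lcP_neq0 tailP_P w.
exists r => //; apply: linspan_trans r_irr => _ [u u_irr ->].
by apply: linspan_gen; exists u => //; apply/mem_P_irred.
Qed.

Lemma independent_P n f :
  ideal f -> linspan (mons mon (fun u => u \in P n)) f -> f = 0.
Proof.
move=> fI fP; apply: (ideal_irred_eq0 monM ext_mon lcP_neq0 tailP_P confluent_P fI).
apply: linspan_trans fP => _ [u /mem_P_irred[u_irr _] ->].
by apply: linspan_gen; exists u.
Qed.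

(** ** The basis Q *)

Definition lcQ (n : nat) : k := if odd n then c else 1.

Lemma lcQ_neq0 n : at_least2 n -> lcQ n != 0.
Proof. by rewrite /lcQ; case: odd => _; rewrite ?oner_eq0 ?c_neq0. Qed.

(** The remainder modulo 2 is the square of the difference of the two indices. *)
Lemma sm_middle n : (2 * sm (middle n) = n ^ 2 + n %% 2)%N.
Proof.
rewrite /middle smM !sm_xmon.
have [p [r [-> r2]]] : exists p r, (n = 2 * p + r /\ r < 2)%N.
  by exists (n %/ 2)%N, (n %% 2)%N; lia.
rewrite (_ : (2 * p + r) %/ 2 = p)%N; last lia.
rewrite (_ : 2 * p + r - p = p + r)%N; last lia.
rewrite (_ : (2 * p + r) %% 2 = r)%N; last lia.
by case: r r2 => [|[|]] //= _; nia.
Qed.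

Lemma tailP_Q n : at_least2 n ->
  linspan (mons mon (below colevel wt (middle n))) (G n - lcQ n *: mon (middle n)).
Proof.
rewrite /at_least2 => n2.
have -> : lcQ n = coef n (n %/ 2).
  rewrite /coef (_ : (n %/ 2 == 0)%N = false); last lia.
  case: ifP => n2E; rewrite /lcQ.
    by rewrite (_ : odd n = false) //; lia.
  rewrite (_ : odd n = true); last lia.
  by rewrite (_ : n - 2 * (n %/ 2) = 1)%N //; lia.
apply: quadric_tail => //; first lia.
move=> i ni i2; apply: below_colevel; first by rewrite wtM !wt_xmon wt_middle; lia.
rewrite /middle !smM !sm_xmon.
have [e [e0 Ee]] : exists e, (0 < e /\ n %/ 2 = i + e)%N.
  by exists (n %/ 2 - i)%N; lia.
have [f Ef] : exists f, (n = i + e + (i + e + f))%N.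
  by exists (n - 2 * (i + e))%N; lia.
rewrite Ee Ef (_ : _ - (i + e) = i + e + f)%N; last lia.
rewrite (_ : _ - i = i + e + e + f)%N; last lia.
nia.
Qed.

(** Put [N = i + q].  Twice the square moment of [x_b * middle (N - b)] is
    [3b^2 - 2bN + N^2] plus the parity of [N - b], a convex function of [b] with
    minimum near [N / 3].  At [b = q] the monomial is the overlap itself, and so
    it is at [b = p]: outside the interval from [p] to [q] the moment is
    larger. *)
Lemma overlap_minimal p i j q b : (0 < p)%N -> overlapping p i j q ->
  (b < i + q)%N -> b != p -> b != q -> (p < b < q)%N \/
  (sm (mmul (xmon q) (middle i)) < b ^ 2 + sm (middle (i + q - b)))%N.
Proof.
move=> p0 ov bN bp bq; rewrite smM sm_xmon.
have := sm_middle i; have := sm_middle (i + q - b).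
move: (sm (middle i)) (sm (middle (i + q - b))) => A B.
have [M EM] : exists M, (i + q - b = M)%N by exists (i + q - b)%N.
rewrite EM -!mulnn => HB HA.
have {}HB : (M * M <= 2 * B)%N by rewrite HB leq_addr.
have {}HA : (2 * A <= i * i + 1)%N /\ (~~ odd i -> 2 * A = i * i)%N by lia.
have [lt_bp|le_pb] := ltnP b p.
  have [e [e0 Ee]] : exists e, (0 < e /\ p = b + e)%N by exists (p - b)%N; lia.
  right; case: ov => -[Ei Ej Eq].
  - have EM' : (M = 2 * b + 3 * e + 1)%N by lia.
    have {}HA : (2 * A = i * i)%N by apply HA; rewrite Ei; lia.
    by move: HA HB e0; rewrite EM' Ei Eq Ee; clear; nia.
  - have EM' : (M = 2 * b + 3 * e + 2)%N by lia.
    by move: HA.1 HB e0; rewrite EM' Ei Eq Ee; clear; nia.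
  - have EM' : (M = 2 * b + 3 * e + 3)%N by lia.
    by move: HA.1 HB e0; rewrite EM' Ei Eq Ee; clear; nia.
have [lt_qb|le_bq] := ltnP q b; last by left; clear -le_pb le_bq bp bq; lia.
have [e [e0 Ee]] : exists e, (0 < e /\ b = q + e)%N by exists (b - q)%N; lia.
right; case: ov => -[Ei Ej Eq].
- have EM' : (M + e = 2 * p)%N by lia.
  have {}HA : (2 * A = i * i)%N by apply HA; rewrite Ei; lia.
  by move: HA HB e0 EM'; rewrite Ee Ei Eq; clear; nia.
- have EM' : (M + e = 2 * p + 1)%N by lia.
  by move: HA.1 HB e0 EM'; rewrite Ee Ei Eq; clear; nia.
- have EM' : (M + e = 2 * p + 1)%N by lia.
  by move: HA.1 HB e0 EM'; rewrite Ee Ei Eq; clear; nia.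
Qed.

(** The dangerous term [x_{p+1} g_{2p+2}] at [N = 3p + 3], whose leading monomial
    [x_{p+1}^3] is larger than the overlap [x_p x_{p+1} x_{p+2}], is absent from
    the syzygy. *)
Lemma overlap_gap p i j q b : overlapping p i j q ->
  (p < b < q)%N -> d (i + q + 2 * b) = 0.
Proof.
case=> -[-> _ ->] pbq; [lia|lia|].
by rewrite (@eq_dcoef _ _ _ 0) //; lia.
Qed.

Lemma overlap_low_term (w u : monom) b n : b + n = wt w -> (2 <= n)%N ->
  (sm w < b ^ 2 + sm (middle n))%N ->
  low_multiple mon at_least2 G middle colevel (colevel (mmul u w))
    (mon u * (y b * G n)).
Proof.
move=> bn n2 smw; exists n, (mmul u (xmon b)); split=> //; last first.
  by rewrite yE monM mulrA.
apply: colevel_lt.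
  by rewrite (wtM u w) (wtM _ (middle n)) (wtM u) wt_xmon wt_middle -bn addnA.
by rewrite (smM u w) (smM _ (middle n)) (smM u) sm_xmon -addnA ltn_add2l.
Qed.

(** The leading terms of the multiples of [g_i] and [g_j] by [x_q] and [x_p]
    cancel in the syzygy, so that these multiples contribute a nonzero scalar
    times the S-pair. *)
Lemma overlap_coef p i j q : (0 < p)%N -> overlapping p i j q ->
  lcQ i * d (i + q + 2 * q) != 0 /\
  lcQ i * d (i + q + 2 * q) + lcQ j * d (i + q + 2 * p) = 0.
Proof.
have c0 : c * c != 0 by rewrite mulf_neq0 // c_neq0.
move=> p0 [] [-> -> ->]; rewrite /lcQ.
- have -> : odd (2 * p) = false by lia.
  have -> : odd (2 * p).+1 = true by lia.
  have -> : d (2 * p + p.+1 + 2 * p.+1) = d 3 by apply: eq_dcoef; lia.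
  have -> : d (2 * p + p.+1 + 2 * p) = d 1 by apply: eq_dcoef; lia.
  by rewrite /dcoef /= mul1r mulr1 oppr_eq0 addNr c_neq0.
- have -> : odd (2 * p.+1) = false by lia.
  have -> : odd (2 * p).+1 = true by lia.
  have -> : d ((2 * p).+1 + p.+1 + 2 * p.+1) = d 4 by apply: eq_dcoef; lia.
  have -> : d ((2 * p).+1 + p.+1 + 2 * p) = d 2 by apply: eq_dcoef; lia.
  by rewrite /dcoef /= mulrN mulr1 mul1r oppr_eq0 addNr c_neq0.
- have -> : odd (2 * p.+1).+1 = true by lia.
  have -> : odd (2 * p).+1 = true by lia.
  have -> : d ((2 * p).+1 + p.+2 + 2 * p.+2) = d 2 by apply: eq_dcoef; lia.
  have -> : d ((2 * p).+1 + p.+2 + 2 * p) = d 3 by apply: eq_dcoef; lia.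
  by rewrite /dcoef /= mulrN subrr.
Qed.

Lemma confluent_overlap p i j q u : (0 < p)%N -> overlapping p i j q ->
  linspan (low_multiple mon at_least2 G middle colevel
             (colevel (mmul (mmul u (xmon q)) (middle i))))
    (Spair mon G lcQ i (mmul u (xmon q)) j (mmul u (xmon p))).
Proof.
move=> p0 ov; have [a0 ab] := overlap_coef p0 ov.
set w := mmul (xmon q) (middle i).
have wtw : wt w = (i + q)%N by rewrite wtM wt_xmon wt_middle addnC.
have N0 : (0 < i + q)%N by case: ov => -[-> _ _]; lia.
have jp : (j + p = i + q)%N by case: ov => -[-> -> ->]; lia.
have pq : p != q by case: ov => -[_ _ ->]; lia.
have i2 : (2 <= i)%N by case: ov => -[-> _ _]; lia.
have j2 : (2 <= j)%N by case: ov => -[_ -> _]; lia.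
have := syzygy cc char5 var N0.
rewrite (bigD1_seq q) ?mem_index_iota ?iota_uniq //=; last lia.
rewrite big_mkcond (bigD1_seq p) ?mem_index_iota ?iota_uniq //=; last by move: jp; lia.
rewrite pq.
rewrite (_ : i + q - q = i)%N; last lia.
rewrite (_ : i + q - p = j)%N; last lia.
(* [al] and [be] are the coefficients of [x_q g_i] and [x_p g_j]; every other
   term of the syzygy goes to the right-hand side of [E]. *)
set al := d (i + q + 2 * q); set be := d (i + q + 2 * p); set rest := \sum_(_ <- _ | _) _.
rewrite -addrA -addrA addrA => /eqP; rewrite addr_eq0 => /eqP E.
have -> : Spair mon G lcQ i (mmul u (xmon q)) j (mmul u (xmon p))
   = (lcQ i * al)^-1 *: (mon u * (al *: (y q * G i) + be *: (y p * G j))).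
  have al0 : al != 0 by apply: contraNneq a0; rewrite /al => ->; rewrite mulr0.
  have li0 := lcQ_neq0 i2; have lj0 := lcQ_neq0 j2.
  rewrite /Spair !monM -!yE; move: (G i) (G j) => Gi Gj.
  rewrite mulrDr scalerDr -!scalerAr !scalerA -!mulrA.
  congr (_ *: _ + _); first by rewrite invfM -mulrA mulVf ?mulr1.
  rewrite -scaleNr; congr (_ *: _).
  have -> : be = - (lcQ i * al) / lcQ j.
    have -> : lcQ i * al = - (lcQ j * be) by apply/eqP; rewrite -addr_eq0; apply/eqP.
    by rewrite opprK (mulrC _ be) mulfK.
  by rewrite mulrA mulrN mulVf ?mulN1r // mulf_neq0.
rewrite E -(mulmA u) -/w; apply: linspanZ; rewrite mulrN; apply: linspanN.
rewrite mulrDr; apply: linspanD.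
  rewrite /rest mulr_sumr big_nat_cond; apply: linspan_sum => b.
  move=> /andP[/andP[_ bN] bp]; case: ifP => bq; last by rewrite mulr0; exact: linspan0.
  rewrite -scalerAr.
  have [bN1|bN1] := eqVneq (i + q - b)%N 1%N.
    by rewrite bN1 quadric1 mulr0 mulr0 scaler0; exact: linspan0.
  have [pbq|sm_lt] := overlap_minimal p0 ov bN bp bq.
    by rewrite (overlap_gap ov pbq) scale0r; exact: linspan0.
  apply/linspanZ/linspan_gen/overlap_low_term => //; last lia.
  by rewrite wtw; lia.
(* The last term of the syzygy is compared as if it were the term [b = 0]. *)
rewrite -scalerAr -[G (i + q)]mul1r -[1]/(y 0); apply/linspanZ/linspan_gen.
apply: overlap_low_term; rewrite ?wtw //; first by clear -i2; lia.
have p0' : 0%N != p by clear -p0; lia.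
have q0' : 0%N != q by case: ov => -[_ _ ->].
by have [//|] := overlap_minimal p0 ov N0 p0' q0'; rewrite subn0.
Qed.

Lemma confluent_Q_lt i j : at_least2 i -> at_least2 j -> (i < j)%N ->
  confluent mon at_least2 G middle lcQ colevel i j.
Proof.
move=> i2 j2 ij; have [copr|[q ov]] := middle_coprime_or_overlap i2 ij.
  apply: (coprime_confluent monM lcQ_neq0 tailP_Q) => // m m'.
  exact: coprime_cofactors.
have p0 : (0 < i %/ 2)%N by move: i2; rewrite /at_least2; lia.
move=> m m' /(overlap_cofactors p0 ov)[u [-> ->]].
exact: confluent_overlap.
Qed.

Lemma confluent_Q i j : at_least2 i -> at_least2 j ->
  confluent mon at_least2 G middle lcQ colevel i j.
Proof.
move=> i2 j2; case: (ltngtP i j) => [ij|ji|->].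
- exact: confluent_Q_lt.
- by apply/confluent_sym/confluent_Q_lt.
- exact: confluent_diag.
Qed.

Lemma linspan_Q w : exists2 r,
  linspan (mons mon (fun u => u \in Q (wt w))) r & ideal (mon w - r).
Proof.
have [r r_irr r_eq] := linspan_reduce monM lcQ_neq0 tailP_Q w.
exists r; last exact/ideal_at_least2.
apply: linspan_trans r_irr => _ [u u_irr ->].
by apply: linspan_gen; exists u => //; apply/mem_Q_irred.
Qed.

Lemma independent_Q n f :
  ideal f -> linspan (mons mon (fun u => u \in Q n)) f -> f = 0.
Proof.
move=> /ideal_at_least2 fI fQ.
apply: (ideal_irred_eq0 monM ext_mon lcQ_neq0 tailP_Q confluent_Q fI).
apply: linspan_trans fQ => _ [u /mem_Q_irred[u_irr _] ->].
by apply: linspan_gen; exists u.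
Qed.

End Bases.

(** * Transition matrices *)

(** Substituting the expansions of the [e2 u] into that of [e1 t] expresses
    [e1 t] in terms of the family [e1] itself, and freeness modulo the subspace
    identifies the coefficients with those of the trivial expression. *)
Lemma transition_mul (k : fieldType) (V : lmodType k) (X : V -> Prop)
    (T1 T2 : finType) (e1 : T1 -> V) (e2 : T2 -> V)
    (a : T1 -> T2 -> k) (b : T2 -> T1 -> k) :
  (forall z, linspan X (\sum_t z t *: e1 t) -> forall t, z t = 0) ->
  (forall t, linspan X (e1 t - \sum_u a t u *: e2 u)) ->
  (forall u, linspan X (e2 u - \sum_t b u t *: e1 t)) ->
  forall t t', \sum_u a t u * b u t' = (t == t')%:R.
Proof.
move=> indep ea eb t t'.
pose z r := (t == r)%:R - \sum_u a t u * b u r.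
suff /indep/(_ t')/subr0_eq : linspan X (\sum_r z r *: e1 r) by [].
have -> : \sum_r z r *: e1 r
  = (e1 t - \sum_u a t u *: e2 u) + \sum_u a t u *: (e2 u - \sum_r b u r *: e1 r).
  under [X in _ + X]eq_bigr do rewrite scalerBr.
  rewrite sumrB addrA subrK; under eq_bigr do rewrite scalerBl.
  rewrite sumrB; congr (_ - _).
    rewrite (bigD1 t) //= eqxx scale1r big1 ?addr0 // => r rt.
    by rewrite eq_sym (negbTE rt) scale0r.
  under eq_bigr do rewrite scaler_suml; rewrite exchange_big /=.
  apply: eq_bigr => u _; rewrite scaler_sumr; apply: eq_bigr => r _.
  by rewrite scalerA.
by apply: linspanD => //; apply: linspan_sum => u _; apply: linspanZ.
Qed.

Section InverseMatrices.
Variables (k : fieldType) (T1 T2 : finType).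
Variables (a : T1 -> T2 -> k) (b : T2 -> T1 -> k).
Hypothesis ab : forall t t', \sum_u a t u * b u t' = (t == t')%:R.
Hypothesis ba : forall u u', \sum_t b u t * a t u' = (u == u')%:R.

Lemma inverse_card_le (U1 U2 : finType) (f : U1 -> U2 -> k) (h : U2 -> U1 -> k) :
  (forall t t', \sum_u f t u * h u t' = (t == t')%:R) -> (#|U1| <= #|U2|)%N.
Proof.
move=> fh; pose F := \matrix_(i < #|U1|, j < #|U2|) f (enum_val i) (enum_val j).
pose H := \matrix_(i < #|U2|, j < #|U1|) h (enum_val i) (enum_val j).
apply: (@mulmx1_min _ _ _ F H); apply/matrixP => i j; rewrite !mxE.
rewrite -(inj_eq enum_val_inj) -fh [RHS](reindex (@enum_val U2 predT)) /=; last first.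
  by apply: onW_bij; exact: enum_val_bij.
by apply: eq_bigr => u _; rewrite !mxE.
Qed.

Lemma inverse_card : #|T1| = #|T2|.
Proof. by apply/eqP; rewrite eqn_leq (inverse_card_le ab) (inverse_card_le ba). Qed.

Lemma inverse_unitmx m (row : 'I_m -> T2) (col : 'I_m -> T1) :
  bijective row -> bijective col ->
  \matrix_(i < m, j < m) a (col j) (row i) \in unitmx.
Proof.
move=> row_bij col_bij; pose B := \matrix_(i < m, j < m) b (row j) (col i).
suff /mulmx1_unit[] : \matrix_(i < m, j < m) a (col j) (row i) *m B = 1%:M by [].
apply/matrixP => i j; rewrite !mxE eq_sym -(inj_eq (bij_inj row_bij)) -ba.
rewrite [RHS](reindex col) /=; last exact: onW_bij.
by apply: eq_bigr => l _; rewrite !mxE mulrC.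
Qed.

(** A nonzero determinant has a nonzero term in its Leibniz expansion. *)
Lemma inverse_matching :
  exists pi : T1 -> T2, bijective pi /\ forall t, a t (pi t) != 0.
Proof.
pose col (j : 'I_#|T1|) : T1 := enum_val j.
pose row (i : 'I_#|T1|) : T2 := enum_val (cast_ord inverse_card i).
have col_bij : bijective col by exact: enum_val_bij.
have row_bij : bijective row.
  apply: (@bij_comp _ _ _ (@enum_val T2 predT)); first exact: enum_val_bij.
  by exists (cast_ord (esym inverse_card)); [exact: cast_ordK | exact: cast_ordKV].
have := inverse_unitmx row_bij col_bij; rewrite unitmxE unitfE => det_neq0.
have [s s_neq0] : exists s : {perm 'I_#|T1|}, \prod_i a (col (s i)) (row i) != 0.
  apply/existsP; apply: contraNT det_neq0; rewrite negb_exists => /forallP s0.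
  rewrite /determinant big1 // => s _.
  have /negPn/eqP prod0 := s0 s.
  under eq_bigr do rewrite mxE; by rewrite prod0 mulr0.
exists (fun t => row (s^-1%g (enum_rank t))); split.
  apply: (bij_comp row_bij); apply: bij_comp; last exact: enum_rank_bij.
  exact: injF_bij (@perm_inj _ _).
move=> t; move/prodf_neq0: s_neq0 => /(_ (s^-1%g (enum_rank t)) isT).
by rewrite permKV /col enum_rankK.
Qed.

End InverseMatrices.

(** * Normal forms *)

Section NormalForm.
Variables (k : fieldType) (c : k).
Hypothesis cc : c ^+ 2 + c = 1.
Hypothesis char5 : 5%N \notin [pchar k].
Local Notation S := {malg k[monom]}.
Local Notation mono := (mono k).

Local Notation I := (ideal c mono).

Lemma monoM (a b : monom) : mono (mmul a b) = mono a * mono b.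
Proof. by rewrite malgM_def fgmulUU mulr1. Qed.

Lemma linspan_mono f : linspan (mons mono (fun=> True)) f.
Proof.
rewrite [f]monalgE; apply: linspan_sum => w _.
have -> : << f@_w *g w >> = f@_w *: mono w.
  apply/malgP => m.
  rewrite (mcoeffU w f@_w m) (mcoeffZ f@_w (mono w) m) /Defs.mono (mcoeffU1 k w m).
  by case: (w == m); rewrite ?mulr1 ?mulr0.
by apply/linspanZ/linspan_gen; exists w.
Qed.

Lemma mcoeff_combination (A : {fset monom}) (a : A -> k) (t : A) :
  (\sum_(u : A) a u *: mono (val u))@_(val t) = a t.
Proof.
have E u : (a u *: mono (val u))@_(val t) = a u * (u == t)%:R.
  rewrite (mcoeffZ (a u) (mono (val u)) (val t)) (mcoeffU1 k (val u) (val t)).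
  by rewrite (inj_eq val_inj).
transitivity (\sum_(u : A) a u * (u == t)%:R).
  apply: etrans (raddf_sum (mcoeff (val t)) _ _ _) _.
  by apply: eq_bigr => u _; exact: E.
by rewrite (bigD1 t) //= eqxx mulr1 big1 ?addr0 // => u /negbTE ->; rewrite mulr0.
Qed.

Lemma in_IE f : in_I c f <-> I f.
Proof. exact: (ideal_seqP c monoM (erefl _) f linspan_mono). Qed.

Lemma in_VE n f : in_V n f <-> linspan (mons mono (fun w => w \in Q n)) f.
Proof. exact: (linspan_monsP mono (Q n) f). Qed.

Let ext (F : monom -> S) : {linear S -> S} := @extension k S F.

Lemma ext_mono F w : ext F (mono w) = F w.
Proof. exact: extension_mono. Qed.

Lemma free_P n (z : P n -> k) :
  I (\sum_t z t *: mono (val t)) -> forall t, z t = 0.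
Proof.
move=> zI t; rewrite -(mcoeff_combination z t).
have zP : linspan (mons mono (fun w => w \in P n)) (\sum_t z t *: mono (val t)).
  by apply/linspan_monsP; exists z.
rewrite (independent_P cc char5 monoM (erefl _) ext_mono zI zP).
exact: mcoeff0.
Qed.

Lemma free_Q n (z : Q n -> k) :
  I (\sum_t z t *: mono (val t)) -> forall t, z t = 0.
Proof.
move=> zI t; rewrite -(mcoeff_combination z t).
have zP : linspan (mons mono (fun w => w \in Q n)) (\sum_t z t *: mono (val t)).
  by apply/linspan_monsP; exists z.
rewrite (independent_Q cc char5 monoM (erefl _) ext_mono zI zP).
exact: mcoeff0.
Qed.

(** The definite description behind [NF] is justified: existence is division by
    all the [g_n], uniqueness is the independence of [Q n] modulo [I]. *)
Lemma NF_spec n f : wt f = n -> in_V n (NF c n (mono f)) /\ in_I c (mono f - NF c n (mono f)).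
Proof.
move=> wf; pose Pr r := in_V n r /\ in_I c (mono f - r).
suff ex : exists r, unique Pr r.
  by have [] := epsilon_spec (inhabits 0) (unique Pr) ex.
have [r r_V r_I] := linspan_Q cc char5 monoM (erefl _) f.
rewrite wf in r_V; exists r; split; first by split; [exact/in_VE | exact/in_IE].
move=> r' [/in_VE r'_V /in_IE r'_I]; apply/subr0_eq.
apply: (independent_Q cc char5 monoM (erefl _) ext_mono _ (linspanB r_V r'_V)).
have -> : r - r' = (mono f - r') - (mono f - r).
  by rewrite opprB [RHS]addrC addrA subrK.
exact: linspanB.
Qed.

Lemma expand_P n (w : P n) :
  I (mono (val w) - \sum_(u : Q n) M c u w *: mono (val u)).
Proof.
have [wn _] := (mem_P n (val w)).1 (fsvalP w).
have [[a NF_a] /in_IE NF_I] := NF_spec wn.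
suff -> : \sum_(u : Q n) M c u w *: mono (val u) = NF c n (mono (val w)) by [].
have coef_a u : M c u w = a u.
  exact: etrans (congr1 (mcoeff (val u)) NF_a) (mcoeff_combination a u).
transitivity (\sum_(u : Q n) a u *: mono (val u)); last exact: esym NF_a.
by apply: eq_bigr => u _; apply: (congr1 (fun e => e *: mono (val u))).
Qed.

Lemma expand_Q n : exists b : Q n -> P n -> k, forall u : Q n,
  I (mono (val u) - \sum_(t : P n) b u t *: mono (val t)).
Proof.
suff ex (u : Q n) : exists b : P n -> k,
    I (mono (val u) - \sum_(t : P n) b t *: mono (val t)).
  exists (fun u => sval (constructive_indefinite_description _ (ex u))) => u.
  by case: constructive_indefinite_description.
have [un _] := (mem_Q n (val u)).1 (fsvalP u).
have [r] := linspan_P cc char5 monoM (erefl _) (val u).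
by rewrite un => /linspan_monsP[b ->] rI; exists b.
Qed.

End NormalForm.

Theorem proposition5p1 (k : fieldType) (c : k) (n : nat) :
  5%N \notin [pchar k] ->
  c ^+ 2 + c = 1 ->
  #|` P n| = #|` Q n|
  /\ (forall (m : nat) (row_idx : 'I_m -> Q n) (col_idx : 'I_m -> P n),
        bijective row_idx -> bijective col_idx ->
        \matrix_(i < m, j < m) M c (row_idx i) (col_idx j) \in unitmx)
  /\ (exists pi : P n -> Q n,
        bijective pi
        /\ forall lambda : P n,
             (NF c n (mono k (val lambda)))@_(val (pi lambda)) != 0).
Proof.
move=> char5 cc; have [b b_eq] := expand_Q cc char5 n.
have ab := transition_mul (@free_P _ _ cc char5 n) (expand_P cc char5 (n := n)) b_eq.
have ba := transition_mul (@free_Q _ _ cc char5 n) b_eq (expand_P cc char5 (n := n)).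
split; first by rewrite !cardfE; exact: inverse_card ab ba.
split=> [m row col row_bij col_bij|]; first exact: (inverse_unitmx ba row_bij col_bij).
exact: (inverse_matching ab ba).
Qed.
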